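(* Let $K$ be a perfect field, $L$ a field extension of $K$, $V_1,\dots,V_d$ finite-dimensional $K$-vector spaces, $V=V_1\otimes_K\cdots\otimes_K V_d$, $v\in V$ and $\alpha\in\mathbb{R}^d_{>0}$. Let $\overline{V}_i=L\otimes_K V_i$ and let $\overline{v}=1\otimes v\in \overline{V}=L\otimes_K V\cong \overline{V}_1\otimes_L\cdots\otimes_L\overline{V}_d$. Then $$\operatorname{rk}^G_\alpha(v)=\operatorname{rk}^G_\alpha(\overline{v}),$$ where the left-hand side is the $G$-stable $\alpha$-rank computed over $K$ and the right-hand side is the $G$-stable $\alpha$-rank computed over $L$.
   Context: $G$-stable rank over a field $F$ (applied with $F=K$ and the spaces $V_i$, or $F=L$ and the spaces $\overline V_i$): let $U_1,\dots,U_d$ be finite-dimensional $F$-vector spaces, $U=U_1\otimes_F\cdots\otimes_F U_d$. For an $F$-vector space $W$ and $v(t)\in F((t))\otimes_F W$, $\operatorname{val}_t(v(t))$ is the largest integer $m$ with $v(t)\in t^m(F[[t]]\otimes_F W)$, and $\operatorname{val}_t(0)=\infty$. Let $\mathrm{GL}(U_i,F[[t]])$ be the set of elements of $F[[t]]\otimes_F\operatorname{End}(U_i)$ that are invertible over $F((t))$ (the inverse need not have entries in $F[[t]]$), and $G(F[[t]])=\prod_i\mathrm{GL}(U_i,F[[t]])$, acting on $F((t))\otimes_F U$ factorwise. For $u\in U$ and $\alpha\in\mathbb{R}^d_{>0}$, $\operatorname{rk}^G_\alpha(u)$ is the infimum of $$\mu_\alpha(g(t),u)=\frac{\sum_{i=1}^d\alpha_i\operatorname{val}_t(\det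 g_i(t))}{\operatorname{val}_t(g(t)\cdot u)}$$ over all $g(t)=(g_1(t),\dots,g_d(t))\in G(F[[t]])$ with $\operatorname{val}_t(g(t)\cdot u)>0$ (a quotient with denominator $\infty$ is $0$). *)

(* Defs.v *)
From HB Require Import structures.
From mathcomp Require Import all_boot all_order all_algebra all_field.
From mathcomp Require Import all_classical all_reals ereal.

Set Implicit Arguments.
Unset Strict Implicit.
Unset Printing Implicit Defensive.

Import Order.TTheory GRing.Theory Num.Theory.

Local Open Scope classical_set_scope.
Local Open Scope ring_scope.

Definition perfect_field (K : fieldType) : Prop :=
  forall p : {poly K}, irreducible_poly p -> separable_poly p.

(* [fps F] is F[[t]].  A record is used because the function type nat -> F
   already carries the pointwise ring structure. *)
Record fps (F : Type) := Fps { fps_coef : nat -> F }.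

HB.instance Definition _ (F : Type) := gen_eqMixin (fps F).
HB.instance Definition _ (F : Type) := gen_choiceMixin (fps F).

Section PowerSeries.
Variable F : fieldType.
Implicit Types f g h : fps F.

Local Notation "f `[ n ]" := (fps_coef f n) (at level 2, format "f `[ n ]").

Lemma fpsP f g : (forall n, f`[n] = g`[n]) -> f = g.
Proof. by case: f g => [f] [g] /= fg; congr Fps; apply/funext. Qed.

Definition fps_const (c : F) := Fps (fun n => if n == 0%N then c else 0).
Definition fps_X : fps F := Fps (fun n => (n == 1%N)%:R).

Definition fps_add f g := Fps (fun n => f`[n] + g`[n]).
Definition fps_opp f := Fps (fun n => - f`[n]).
Definition fps_mul f g := Fps (fun n => \sum_(i < n.+1) f`[i] * g`[n - i]).

Lemma fps_addA : associative fps_add.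
Proof. by move=> f g h; apply: fpsP => n /=; rewrite addrA. Qed.

Lemma fps_addC : commutative fps_add.
Proof. by move=> f g; apply: fpsP => n /=; rewrite addrC. Qed.

Lemma fps_add0 : left_id (fps_const 0) fps_add.
Proof. by move=> f; apply: fpsP => n /=; rewrite if_same add0r. Qed.

Lemma fps_addN : left_inverse (fps_const 0) fps_opp fps_add.
Proof. by move=> f; apply: fpsP => n /=; rewrite if_same addNr. Qed.

HB.instance Definition _ :=
  GRing.isZmodule.Build (fps F) fps_addA fps_addC fps_add0 fps_addN.

(* The product is computed on truncations, so that associativity and
   commutativity are inherited from polynomials. *)
Let trunc n f : {poly F} := \poly_(i < n.+1) f`[i].

Let truncE n f i : (i <= n)%N -> (trunc n f)`_i = f`[i].
Proof. by move=> le_in; rewrite coef_poly ltnS le_in. Qed.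

Let trunc_mul n f g i :
  (i <= n)%N -> (fps_mul f g)`[i] = (trunc n f * trunc n g)`_i.
Proof.
move=> le_in; rewrite coefM; apply: eq_bigr => j _.
have le_ji : (j <= i)%N by rewrite -ltnS.
by rewrite !truncE// (leq_trans _ le_in)// leq_subr.
Qed.

Lemma fps_mulC : commutative fps_mul.
Proof. by move=> f g; apply: fpsP => n; rewrite !(@trunc_mul n)// mulrC. Qed.

Lemma fps_mulA : associative fps_mul.
Proof.
move=> f g h; apply: fpsP => n.
transitivity (trunc n f * (trunc n g * trunc n h))`_n.
  rewrite coefM; apply: eq_bigr => i _.
  by rewrite (@trunc_mul n) ?leq_subr// truncE// -ltnS.
rewrite mulrA coefM; apply: eq_bigr => i _.
have le_in : (i <= n)%N by rewrite -ltnS.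
by rewrite (truncE h) ?leq_subr// -trunc_mul.
Qed.

Lemma fps_mul1 : left_id (fps_const 1) fps_mul.
Proof.
move=> f; apply: fpsP => n /=; rewrite big_ord_recl/= subn0 mul1r.
by rewrite big1 ?addr0// => i _; rewrite mul0r.
Qed.

Lemma fps_mulDl : left_distributive fps_mul fps_add.
Proof.
move=> f g h; apply: fpsP => n /=; rewrite -big_split/=.
by apply: eq_bigr => i _; rewrite mulrDl.
Qed.

Lemma fps_oner_neq0 : fps_const 1 != 0.
Proof. by apply/eqP => -[] /(congr1 (@^~ 0%N))/= /eqP; rewrite oner_eq0. Qed.

HB.instance Definition _ := GRing.Zmodule_isComNzRing.Build (fps F)
  fps_mulA fps_mulC fps_mul1 fps_mulDl fps_oner_neq0.

Definition fps_unit : {pred fps F} := fun f => `[< exists g, g * f = 1 >].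
Definition fps_inv f :=
  if pselect (exists g, g * f = 1) is left e then projT1 (cid e) else f.

Lemma fps_mulVf : {in fps_unit, left_inverse 1 fps_inv *%R}.
Proof.
move=> f /asboolP Uf; rewrite /fps_inv; case: pselect => // e.
exact: projT2 (cid e).
Qed.

Lemma fps_unitPl f g : g * f = 1 -> fps_unit f.
Proof. by move=> gf1; apply/asboolP; exists g. Qed.

Lemma fps_invr_out : {in [predC fps_unit], fps_inv =1 id}.
Proof.
move=> f nUf; rewrite /fps_inv; case: pselect => // e.
by case/negP: nUf; apply/asboolP.
Qed.

HB.instance Definition _ := GRing.ComNzRing_hasMulInverse.Build (fps F)
  fps_mulVf fps_unitPl fps_invr_out.

Lemma fps_neq0_order f : f != 0 ->
  exists2 n, f`[n] != 0 & forall i, (i < n)%N -> f`[i] = 0.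
Proof.
move=> f0; have f_n : exists n, f`[n] != 0.
  apply/not_existsP => f_0; case/eqP: f0; apply: fpsP => n /=.
  by rewrite if_same; apply/eqP/negPn/negP/f_0.
exists (ex_minn f_n); case: ex_minnP => // m _ min_m i lt_im.
by apply/eqP; apply: contraTT lt_im => /min_m; rewrite -leqNgt.
Qed.

Lemma fps_integral : GRing.integral_domain_axiom (fps F).
Proof.
move=> f g fg0; apply: contraT; rewrite negb_or.
move=> /andP[/fps_neq0_order[m fm ltm] /fps_neq0_order[n gn ltn]].
have /= := congr1 (fun h => h`[m + n]) fg0.
have lt_m : (m < (m + n).+1)%N by rewrite ltnS leq_addr.
rewrite if_same (bigD1 (Ordinal lt_m))//= big1 => [|i neq_im].
  by move/eqP; rewrite addr0 addKn mulf_eq0 (negPf fm) (negPf gn).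
have [lt_im|le_mi] := ltnP i m; first by rewrite ltm ?mul0r.
have lt_mi : (m < i)%N.
  rewrite ltn_neqAle le_mi andbT; apply: contraNneq neq_im => m_i.
  exact/eqP/val_inj.
by rewrite ltn ?mulr0// ltn_subLR ?ltn_add2r// -ltnS.
Qed.

HB.instance Definition _ :=
  GRing.ComUnitRing_isIntegral.Build (fps F) fps_integral.

End PowerSeries.

(* F((t)), as the fraction field of F[[t]]. *)
Notation laurent F := {fraction (fps F)}.

Definition laurent_of_fps {F : fieldType} : fps F -> laurent F :=
  @FracField.tofrac (fps F).
HB.instance Definition _ (F : fieldType) :=
  GRing.RMorphism.copy (@laurent_of_fps F) (@FracField.tofrac (fps F)).

Definition laurent_t {F : fieldType} : laurent F := laurent_of_fps (fps_X F).

Definition laurent_const {F : fieldType} (c : F) : laurent F :=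
  laurent_of_fps (fps_const c).

Section LaurentConst.
Variable F : fieldType.

Lemma laurent_const_zmod : zmod_morphism (@laurent_const F).
Proof.
move=> a b; rewrite -rmorphB; congr laurent_of_fps.
by apply: fpsP => n /=; case: eqP => // _; rewrite subr0.
Qed.

Lemma laurent_const_monoid : monoid_morphism (@laurent_const F).
Proof.
split; first exact: rmorph1.
move=> a b; rewrite -rmorphM; congr laurent_of_fps.
apply: fpsP => n /=; rewrite big_ord_recl/= subn0.
rewrite big1 ?addr0 => [|i _]; last by rewrite mul0r.
by case: eqP => // _; rewrite mulr0.
Qed.

HB.instance Definition _ :=
  GRing.isZmodMorphism.Build F (laurent F) laurent_const laurent_const_zmod.
HB.instance Definition _ := GRing.isMonoidMorphism.Build F (laurent F)
  laurent_const laurent_const_monoid.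

End LaurentConst.

Section ScalarExtension.
Variables (F E : fieldType) (iota : {rmorphism F -> E}).

(* E (x)_F W, written in the E-basis (1 (x) e_j)_j where (e_j)_j is the
   basis [vbasis fullv] of W. *)
Definition extension (_ : {rmorphism F -> E}) (W : vectType F) : vectType E :=
  'rV[E]_(\dim {:W}).

(* w |-> 1 (x) w *)
Definition extend (W : vectType F) (w : W) : extension iota W :=
  \row_j iota (coord (vbasis {:W}) j w).

End ScalarExtension.

(* U_1 (x) ... (x) U_d, written in the basis of the pure tensors of the
   vectors of the bases [vbasis fullv] of the U_i. *)
Definition tensor_index (F : fieldType) (d : nat) (U : 'I_d -> vectType F) :=
  {dffun forall i : 'I_d, 'I_(\dim {:U i})}.

Definition tensor (F : fieldType) (d : nat) (U : 'I_d -> vectType F) :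
  vectType F := {ffun tensor_index U -> F^o}.

Definition pure_tensor (F : fieldType) (d : nat) (U : 'I_d -> vectType F)
    (u : forall i, U i) : tensor U :=
  [ffun f : tensor_index U =>
     \prod_(i < d) coord (vbasis {:U i}) (f i) (u i) : F^o].

(* For a field morphism iota and iota-semilinear maps h_i : U_i -> W_i, this is
   the iota-semilinear map h_1 (x) ... (x) h_d. *)
Definition tensor_map (F E : fieldType) (iota : {rmorphism F -> E}) (d : nat)
    (U : 'I_d -> vectType F) (W : 'I_d -> vectType E)
    (h : forall i, U i -> W i) (x : tensor U) : tensor W :=
  \sum_(f : tensor_index U)
    iota (x f) *: pure_tensor (fun i => h i (vbasis {:U i})`_(f i)).

(* v |-> 1 (x) v, followed by the isomorphism of E (x) (U_1 (x) ... (x) U_d)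
   with (E (x) U_1) (x) ... (x) (E (x) U_d). *)
Definition tensor_extend (F E : fieldType) (iota : {rmorphism F -> E})
    (d : nat) (U : 'I_d -> vectType F) :
    tensor U -> tensor (fun i => extension iota (U i)) :=
  tensor_map iota (fun i => @extend F E iota (U i)).

Section TensorTheory.

Lemma bigA_distr_dffun (R : comPzRingType) (I : finType) (J : I -> finType)
    (P : forall i, J i -> R) :
  \prod_i \sum_(j : J i) P i j =
  \sum_(f : {dffun forall i, J i}) \prod_i P i (f i).
Proof.
rewrite (reindex (@dffun_of_fprod I J)) /=; last exact/onW_bij/dffun_of_fprod_bij.
under [RHS]eq_bigr do under eq_bigr do rewrite ffunE.
pose Q i : {ffun J i -> R} := [ffun j => P i j].
transitivity (\prod_i \sum_(j : J i) Q i j).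
  by apply: eq_bigr => i _; apply: eq_bigr => j _; rewrite ffunE.
transitivity (\sum_(t : fprod J) \prod_(i in I) Q i (t i)); last first.
  by apply: eq_bigr => f _; apply: eq_bigr => i _; rewrite ffunE.
rewrite big_fprod; under eq_bigr do rewrite (big_tag (fun i => Q i)).
by rewrite bigA_distr_big_dep; apply: eq_bigl => f.
Qed.

Variables (F E : fieldType) (iota : {rmorphism F -> E}) (d : nat).
Variables (U : 'I_d -> vectType F).

Lemma pure_tensor_basis (f g : tensor_index U) :
  pure_tensor (fun i => (vbasis {:U i})`_(f i)) g = (f == g)%:R.
Proof.
rewrite ffunE; under eq_bigr do
  rewrite coord_free ?(basis_free (vbasisP _))//.
have [->|neq_fg] := eqVneq; first by rewrite big1// => i _; rewrite eqxx.
suff [i neq_i] : exists i, f i != g i.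
  by rewrite (bigD1 i)//= (negPf neq_i) mul0r.
apply/existsP; rewrite -negb_forall; apply: contra neq_fg => /forallP fg.
by apply/eqP/ffunP => i; apply/eqP.
Qed.

Lemma tensor_expand (x : tensor U) :
  x = \sum_f x f *: pure_tensor (fun i => (vbasis {:U i})`_(f i)).
Proof.
apply/ffunP => g; rewrite sum_ffunE (bigD1 g)//= big1 => [|f neq_fg].
  by rewrite ffunE pure_tensor_basis eqxx addr0; apply/esym/mulr1.
by rewrite ffunE pure_tensor_basis (negPf neq_fg); apply: mulr0.
Qed.

Lemma tensor_map_pure (W : 'I_d -> vectType E) (h : forall i, U i -> W i)
    (hD : forall i, {morph h i : x y / x + y})
    (hZ : forall i a, {morph h i : x / a *: x >-> iota a *: x})
    (u : forall i, U i) :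
  tensor_map iota h (pure_tensor u) = pure_tensor (fun i => h i (u i)).
Proof.
have h0 i : h i 0 = 0 by rewrite -(scale0r 0) hZ rmorph0 scale0r.
apply/ffunP => g; rewrite sum_ffunE !ffunE.
transitivity (\sum_(f : tensor_index U) \prod_i
  (iota (coord (vbasis {:U i}) (f i) (u i)) *
   coord (vbasis {:W i}) (g i) (h i (vbasis {:U i})`_(f i)))).
  by apply: eq_bigr => f _; rewrite !ffunE rmorph_prod big_split.
rewrite -(bigA_distr_dffun (fun i j =>
  (iota (coord (vbasis {:U i}) j (u i)) *
   coord (vbasis {:W i}) (g i) (h i (vbasis {:U i})`_j)))).
apply: eq_bigr => i _.
rewrite [in RHS](coord_vbasis (memvf (u i))) (big_morph _ (hD i) (h0 i)).
by rewrite linear_sum; apply: eq_bigr => j _; rewrite hZ linearZ.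
Qed.

Lemma tensor_extend_pure (u : forall i, U i) :
  tensor_extend iota (pure_tensor u) =
  pure_tensor (fun i => extend iota (u i)).
Proof.
apply: tensor_map_pure => [i x y|i a x]; apply/rowP => j.
  by rewrite !mxE linearD rmorphD.
by rewrite !mxE linearZ rmorphM.
Qed.

End TensorTheory.

Section Valuation.
Variables (R : realType) (F : fieldType) (W : Type).
Variables (X : lmodType (laurent F)) (j : W -> X).

(* For X = F((t)) (x)_F W and j w = 1 (x) w, the subset F[[t]] (x)_F W of X,
   i.e. the F[[t]]-linear combinations of the 1 (x) w. *)
Definition integral_lattice : set X :=
  [set x | exists n (s : 'I_n -> fps F) (w : 'I_n -> W),
     x = \sum_(k < n) laurent_of_fps (s k) *: j (w k)].

(* The largest integer m with x in t^m (F[[t]] (x)_F W), as an extended real;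
   the supremum is +oo exactly when all m qualify, i.e. for x = 0. *)
Definition val_t (x : X) : \bar R :=
  ereal_sup [set (m%:~R)%:E | m in
    [set m : int | exists2 y, integral_lattice y & x = laurent_t ^ m *: y]].

End Valuation.

Section StableRank.
Variables (R : realType) (F : fieldType) (d : nat) (U : 'I_d -> vectType F).

(* F[[t]] (x)_F End(U_i) is the ring of square matrices over F[[t]], an
   endomorphism being given by its matrix (acting on row vectors) in the basis
   [vbasis fullv] of U_i. *)
Definition GL_fps (g : forall i, 'M[fps F]_(\dim {:U i})) : Prop :=
  forall i, map_mx laurent_of_fps (g i) \in unitmx.

(* (g_1(t), ..., g_d(t)) . (1 (x) u), as an element of
   F((t)) (x) U = (F((t)) (x) U_1) (x) ... (x) (F((t)) (x) U_d). *)
Definition GL_act (g : forall i, 'M[fps F]_(\dim {:U i})) (u : tensor U) :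
    tensor (fun i => extension laurent_const (U i)) :=
  tensor_map idfun
    (fun i (x : extension laurent_const (U i)) =>
       x *m map_mx laurent_of_fps (g i) : extension laurent_const (U i))
    (tensor_extend laurent_const u).

Definition val_tensor :
    tensor (fun i => extension laurent_const (U i)) -> \bar R :=
  val_t R (@tensor_extend F _ laurent_const d U).

Definition val_scalar : laurent F -> \bar R :=
  @val_t R F F (laurent F)^o laurent_const.

Local Open Scope ereal_scope.

(* A quotient with denominator +oo is 0: in \bar R, (+oo)^-1 = 0. *)
Definition stable_mu (alpha : 'I_d -> R)
    (g : forall i, 'M[fps F]_(\dim {:U i})) (u : tensor U) : \bar R :=
  (\sum_(i < d) (alpha i)%:E * val_scalar (laurent_of_fps (\det (g i))))
    / val_tensor (GL_act g u).

Definition stable_rank (alpha : 'I_d -> R) (u : tensor U) : \bar R :=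
  ereal_inf [set stable_mu alpha g u | g in
    [set g | GL_fps g /\ 0 < val_tensor (GL_act g u)]].

End StableRank.

(* Main.v *)
From HB Require Import structures.
Require Import Defs.
From mathcomp Require Import all_boot all_order all_algebra all_field.
From mathcomp Require Import all_classical all_reals ereal.
From mathcomp Require Import topology normedtype derive.
From mathcomp Require Import ring lra.

(** Why the stable rank is insensitive to the extension L/K.

    The first step removes the power series.  An element g(t) of GL(F[[t]])
    factors as g = a(t) w b(t), with a and b invertible over F[[t]] and w
    having a single nonzero entry in each row and column, the one in row j of
    order lam_j ([smith]).  Multiplying by b does not change the valuation of
    g.u, so val(g.u) >= M says that the coordinate of a(t).u with index J is
    divisible by t^(M - lam_J), where lam_J is the sum of the lam_(i,J_i); in
    particular its constant term vanishes when lam_J < M.  Setting t = 0 in a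
    thus yields a basis of each U_i with weights lam_(i,j) such that every basis
    tensor occurring in u has weight at least M, while the order of det g_i is
    the sum of the lam_(i,j).  Hence rk(u) < r if and only if such
    weighted bases exist with sum_i alpha_i sum_j lam_(i,j) < r M
    ([stable_rank_lt]).  From K to L this condition obviously persists; the
    point is to go from L to K.

    The descent is Kempf's argument.  Among all weighted bases, with real
    weights in [0, 1], one maximizes r M - sum alpha_i lam_(i,j)
    - sum lam_(i,j)^2, a function that is strictly concave in the weights and
    takes a positive value exactly when u is unstable in the above sense.  By
    the Bruhat decomposition any two weighted bases with the same weights can
    be moved, inside the parabolic subgroups fixing their flags, to a common
    basis up to a permutation of the weights; the average of the two
    weightings would then beat the maximum unless the two weightings, and so
    the two flags, coincide ([optimal_parabolic]).  The maximum exists because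
    it depends only on the set of basis tensors occurring in u, for which there
    are finitely many possibilities, and for each of them one maximizes over a
    compact polytope ([instability_max]).  For the optimum to survive further
    field extensions one first enlarges L until no new such set appears in any
    extension ([maximal_extension]).

    The optimal flag is then the same under any two embeddings, over K, of its
    field of definition into a larger field.  As K is perfect, an element of L
    outside K is moved by a suitable pair of embeddings ([two_embeddings]):
    a transcendental x can be sent to x + 1, and an algebraic one to another
    root of its separable minimal polynomial.  The reduced bases of the spaces
    of the flag therefore have entries in K, the flag is defined over K
    ([flag_basis_descent]), and any basis over K adapted to it has the same
    weights.  Approximating the real weights by rational ones finishes the
    proof. *)

Set Implicit Arguments.
Unset Strict Implicit.
Unset Printing Implicit Defensive.

Import Order.TTheory GRing.Theory Num.Theory.
Import numFieldNormedType.Exports.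
Local Open Scope ring_scope.

(** * Simple extensions and pairs of embeddings *)

Section SimpleExtension.
Variables (M L : fieldType) (j : {rmorphism M -> L}) (z : L).

(** This is what makes z |-> y extend b to an embedding of the field M(z):
    equality, rather than implication, lets denominators survive. *)
Definition same_relations (B : fieldType) (b : {rmorphism M -> B}) (y : B) :=
  forall P : {poly M}, root (map_poly j P) z = root (map_poly b P) y.

(** The subfield M(z) of L. *)
Definition simple_pred : {pred L} := fun u =>
  `[< exists P Q : {poly M}, (map_poly j Q).[z] != 0 /\
       u = (map_poly j P).[z] / (map_poly j Q).[z] >].

Lemma simple_pred_divring : divring_closed simple_pred.
Proof.
split.
- apply/asboolP; exists 1, 1; rewrite rmorph1 hornerC oner_neq0.
  by rewrite divr1.
- move=> _ _ /asboolP[P1 [Q1 [Q10 ->]]] /asboolP[P2 [Q2 [Q20 ->]]].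
  apply/asboolP; exists (P1 * Q2 - P2 * Q1), (Q1 * Q2).
  rewrite !(rmorphM, rmorphB) /= !hornerE mulf_neq0//; split=> //.
  by rewrite -mulNr addf_div// mulNr.
- move=> _ _ /asboolP[P1 [Q1 [Q10 ->]]] /asboolP[P2 [Q2 [Q20 ->]]].
  apply/asboolP; have [P20|P20] := eqVneq (map_poly j P2).[z] 0.
    by exists 0, 1; rewrite P20 mul0r invr0 mulr0 rmorph0 rmorph1 !hornerE oner_neq0.
  exists (P1 * Q2), (Q1 * P2).
  by rewrite !rmorphM /= !hornerE mulf_neq0//; split=> //; rewrite invf_div mulf_div.
Qed.

HB.instance Definition _ := GRing.isDivringClosed.Build L simple_pred
  simple_pred_divring.

Record simple_ext := SimpleExt { simple_val : L; _ : simple_val \in simple_pred }.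
HB.instance Definition _ := [isSub for simple_val].
HB.instance Definition _ := [Choice of simple_ext by <:].
HB.instance Definition _ := [SubChoice_isSubComUnitRing of simple_ext by <:].
HB.instance Definition _ :=
  [SubComUnitRing_isSubIntegralDomain of simple_ext by <:].
HB.instance Definition _ := [SubIntegralDomain_isSubField of simple_ext by <:].

Lemma simple_ext_frac (u : simple_ext) : exists PQ : {poly M} * {poly M},
  (map_poly j PQ.2).[z] != 0 /\
  simple_val u = (map_poly j PQ.1).[z] / (map_poly j PQ.2).[z].
Proof. by case: u => u /= /asboolP[P [Q]]; exists (P, Q). Qed.

Lemma simple_pred_poly (P : {poly M}) : (map_poly j P).[z] \in simple_pred.
Proof. by apply/asboolP; exists P, 1; rewrite rmorph1 hornerC oner_neq0 divr1. Qed.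

Definition simple_poly (P : {poly M}) : simple_ext :=
  SimpleExt (simple_pred_poly P).

Definition simple_in (m : M) : simple_ext := simple_poly m%:P.

Lemma simple_in_val m : simple_val (simple_in m) = j m.
Proof. by rewrite /= map_polyC hornerC. Qed.

Lemma simple_in_zmod : zmod_morphism simple_in.
Proof.
move=> a b; apply: val_inj.
by rewrite rmorphB/= !map_polyC/= !hornerC rmorphB.
Qed.

Lemma simple_in_monoid : monoid_morphism simple_in.
Proof.
split=> [|a b]; apply: val_inj.
  by rewrite rmorph1/= map_polyC/= !hornerC rmorph1.
by rewrite rmorphM/= !map_polyC/= !hornerC rmorphM.
Qed.

HB.instance Definition _ :=
  GRing.isZmodMorphism.Build M simple_ext simple_in simple_in_zmod.
HB.instance Definition _ :=
  GRing.isMonoidMorphism.Build M simple_ext simple_in simple_in_monoid.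

Section Lift.
Variables (B : fieldType) (b : {rmorphism M -> B}) (y : B).
Hypothesis rel_y : same_relations b y.

(** The proof that the relations agree is an argument so that the morphism
    structure below can be attached to the function itself. *)
Definition simple_lift_of (_ : same_relations b y) (u : simple_ext) : B :=
  let PQ := projT1 (cid (simple_ext_frac u)) in
  (map_poly b PQ.1).[y] / (map_poly b PQ.2).[y].

Local Notation simple_lift := (simple_lift_of rel_y).

Lemma simple_liftE (u : simple_ext) (P Q : {poly M}) :
  (map_poly j Q).[z] != 0 ->
  simple_val u = (map_poly j P).[z] / (map_poly j Q).[z] ->
  (map_poly b Q).[y] != 0 /\
  simple_lift u = (map_poly b P).[y] / (map_poly b Q).[y].
Proof.
have nz (S : {poly M}) : (map_poly j S).[z] != 0 -> (map_poly b S).[y] != 0.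
  by have := rel_y S; rewrite /root => ->.
move=> Q0 uE; have Q0' := nz _ Q0; split=> //.
rewrite /simple_lift_of; case: cid => -[P1 Q1] /= [Q10 uE1].
have Q10' := nz _ Q10; apply/eqP; rewrite eqr_div// -subr_eq0.
have := rel_y (P1 * Q - P * Q1); rewrite /root !(rmorphB, rmorphM) !hornerE => <-.
by rewrite subr_eq0 -eqr_div// -uE1 uE.
Qed.

Lemma simple_lift_zmod : zmod_morphism simple_lift.
Proof.
move=> u v.
have [[P1 Q1] /= [Q10 uE]] := simple_ext_frac u.
have [[P2 Q2] /= [Q20 vE]] := simple_ext_frac v.
have [Q10' ->] := simple_liftE Q10 uE; have [Q20' ->] := simple_liftE Q20 vE.
have [] := @simple_liftE (u - v) (P1 * Q2 - P2 * Q1) (Q1 * Q2).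
- by rewrite rmorphM hornerM mulf_neq0.
- have -> : simple_val (u - v) = simple_val u - simple_val v by exact: (rmorphB \val).
  rewrite uE vE !(rmorphM, rmorphB) /= !hornerE.
  by rewrite -mulNr addf_div// mulNr.
move=> _ ->; rewrite !(rmorphM, rmorphB) /= !hornerE.
by rewrite -[in RHS]mulNr addf_div// mulNr.
Qed.

Lemma simple_lift_monoid : monoid_morphism simple_lift.
Proof.
split=> [|u v].
  have [] := @simple_liftE 1 1 1.
  - by rewrite rmorph1 hornerC oner_neq0.
  - by rewrite rmorph1 hornerC divr1.
  by move=> _ ->; rewrite rmorph1 hornerC divr1.
have [[P1 Q1] /= [Q10 uE]] := simple_ext_frac u.
have [[P2 Q2] /= [Q20 vE]] := simple_ext_frac v.
have [Q10' ->] := simple_liftE Q10 uE; have [Q20' ->] := simple_liftE Q20 vE.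
have [] := @simple_liftE (u * v) (P1 * P2) (Q1 * Q2).
- by rewrite rmorphM hornerM mulf_neq0.
- have -> : simple_val (u * v) = simple_val u * simple_val v by exact: (rmorphM \val).
  by rewrite uE vE !rmorphM /= !hornerM mulf_div.
by move=> _ ->; rewrite !rmorphM /= !hornerM mulf_div.
Qed.

HB.instance Definition _ :=
  GRing.isZmodMorphism.Build simple_ext B simple_lift simple_lift_zmod.
HB.instance Definition _ :=
  GRing.isMonoidMorphism.Build simple_ext B simple_lift simple_lift_monoid.

Lemma simple_lift_poly P : simple_lift (simple_poly P) = (map_poly b P).[y].
Proof.
have [] := @simple_liftE (simple_poly P) P 1.
- by rewrite rmorph1 hornerC oner_neq0.
- by rewrite rmorph1 hornerC divr1.
by move=> _ ->; rewrite rmorph1 hornerC divr1.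
Qed.

End Lift.
End SimpleExtension.

(** Only the universal property of M(z) is used from here on, so that towers of
    such extensions can be treated as towers of abstract fields. *)
Lemma simple_extension_exists (M L : fieldType) (j : {rmorphism M -> L}) (z : L) :
  exists (N : fieldType) (i : {rmorphism M -> N}) (j' : {rmorphism N -> L}) (w : N),
  [/\ forall m, j' (i m) = j m, j' w = z &
    forall (B : fieldType) (b : {rmorphism M -> B}) (y : B),
      same_relations j z b y ->
      exists2 q : {rmorphism N -> B}, (forall m, q (i m) = b m) & q w = y].
Proof.
exists (simple_ext j z), (simple_in j z).
exists (\val : {rmorphism simple_ext j z -> L}), (simple_poly j z 'X).
split=> [m||B b y rel_y]; first exact: simple_in_val.
  by rewrite /= map_polyX hornerX.
exists (simple_lift_of rel_y) => [m|]; rewrite /= simple_lift_poly.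
  by rewrite map_polyC hornerC.
by rewrite map_polyX hornerX.
Qed.

Lemma minpoly_alternative (M L : fieldType) (j : {rmorphism M -> L}) (z : L) :
  (forall P : {poly M}, root (map_poly j P) z -> P = 0) \/
  exists2 f : {poly M}, irreducible_poly f &
    forall P : {poly M}, root (map_poly j P) z = (f %| P).
Proof.
have [|/existsNP[P0 /not_implyP[rP0 P00]]] :=
  pselect (forall P : {poly M}, root (map_poly j P) z -> P = 0).
  by left.
right; pose S n := `[< exists P : {poly M}, [/\ root (map_poly j P) z, P != 0 &
  size P = n] >].
have exS : exists n, S n.
  by exists (size P0); apply/asboolP; exists P0; split=> //; apply/eqP.
case: (ex_minnP exS) => _ /asboolP[f [rf f0 <-]] min_f.
have fE (P : {poly M}) : root (map_poly j P) z = (f %| P).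
  apply/idP/idP => [rP|/dvdpP[Q ->]]; last by rewrite rmorphM rootM rf orbT.
  rewrite /dvdp; apply: contraT => R0.
  have := min_f (size (P %% f)); rewrite leqNgt ltn_modp f0 => /(_ _)/negP[]//.
  apply/asboolP; exists (P %% f); split=> //.
  move: rP; rewrite {1}(divp_eq P f) rmorphD rmorphM /= /root hornerD hornerM.
  by rewrite (rootP rf) mulr0 add0r.
exists f => //; split.
  rewrite ltnNge; apply: contraL rf => /size1_polyC fC.
  rewrite fC map_polyC /= rootC fmorph_eq0.
  by apply: contra f0 => /eqP f00; rewrite fC f00.
move=> q q1 qf; have /dvdpP[r fr] := qf.
have q0 : q != 0 by apply: contra f0 => /eqP q0; rewrite fr q0 mulr0.
have r0 : r != 0 by apply: contra f0 => /eqP r0; rewrite fr r0 mul0r.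
have: root (map_poly j (r * q)) z by rewrite fE -fr.
rewrite rmorphM rootM => /orP[]; rewrite fE => fd; last by rewrite /eqp qf.
have := dvdp_leq r0 fd; rewrite fr size_mul//.
have: (1 < size q)%N by rewrite ltn_neqAle eq_sym q1 lt0n size_poly_eq0.
case: (size q) => [|[|s]]// _; rewrite addnS /= addnS.
by rewrite ltnNge leq_addr.
Qed.

Lemma root_extension (F : fieldType) (p : {poly F}) : (1 < size p)%N ->
  exists (E : fieldType) (k : {rmorphism F -> E}) (y : E),
    root (map_poly k p) y.
Proof.
move=> p1; pose S n := `[< exists q : {poly F}, [/\ (1 < size q)%N, q %| p &
  size q = n] >].
have exS : exists n, S n by exists (size p); apply/asboolP; exists p.
case: (ex_minnP exS) => _ /asboolP[q [q1 qp <-]] min_q.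
have irr_q : irreducible_poly q.
  split=> // r r1 rq; rewrite -dvdp_size_eqp//.
  have q0 : q != 0 by rewrite -size_poly_gt0 ltnW.
  have r0 : r != 0 by apply: contraNneq q0 => r0; rewrite r0 dvd0p in rq.
  rewrite eqn_leq dvdp_leq//=; apply/min_q/asboolP; exists r; split=> //.
    by rewrite ltn_neqAle eq_sym r1 lt0n size_poly_eq0.
  exact: dvdp_trans qp.
have [E _ [y ry _]] := irredp_FAdjoin irr_q.
exists E, (in_alg E), y.
by have /dvdpP[r ->] := qp; rewrite rmorphM rootM ry orbT.
Qed.

(** A polynomial outside the ideal of f is coprime to f, and remains so over B,
    hence cannot vanish at y. *)
Lemma minpoly_relations (M L B : fieldType) (j : {rmorphism M -> L}) (z : L)
    (b : {rmorphism M -> B}) (y : B) (f : {poly M}) :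
  irreducible_poly f -> (forall P : {poly M}, root (map_poly j P) z = (f %| P)) ->
  root (map_poly b f) y -> same_relations j z b y.
Proof.
move=> [f1 irr_f] fE ry P; rewrite fE.
have [/dvdpP[Q ->]|nfP] := boolP (f %| P); first by rewrite rmorphM rootM ry orbT.
have cop : coprimep (map_poly b f) (map_poly b P).
  rewrite coprimep_map /coprimep; apply: contraR nfP => g1.
  have := irr_f _ g1 (dvdp_gcdl _ _); rewrite /eqp => /andP[_ fg].
  exact: dvdp_trans fg (dvdp_gcdr _ _).
by apply/esym/negbTE; exact: coprimep_root cop ry.
Qed.

(** Over a transcendental z one takes y to be a new indeterminate; otherwise y
    is a root of the minimal polynomial of z, transported to B. *)
Lemma extend_relations (M L B : fieldType) (j : {rmorphism M -> L}) (z : L)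
    (b : {rmorphism M -> B}) :
  exists (E : fieldType) (p : {rmorphism B -> E}) (y : E),
    same_relations j z (p \o b : {rmorphism M -> E}) y.
Proof.
have [tr|[f irr_f fE]] := minpoly_alternative j z; last first.
  have [|E [p [y ry]]] := @root_extension B (map_poly b f).
    by rewrite size_map_poly; case: irr_f.
  exists E, p, y; apply: minpoly_relations irr_f fE _.
  by rewrite map_poly_comp.
pose p : {rmorphism B -> {fraction {poly B}}} :=
  @FracField.tofrac {poly B} \o polyC.
exists {fraction {poly B}}, p, (FracField.tofrac 'X) => P.
have -> : root (map_poly (p \o b) P) (FracField.tofrac 'X) = (P == 0).
  rewrite map_poly_comp (map_poly_comp (@FracField.tofrac {poly B}) polyC).
  rewrite /root horner_map /= tofrac_eq0.
  by have := comp_polyXr (map_poly b P); rewrite /comp_poly => ->; rewrite map_poly_eq0.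
apply/idP/eqP => [/tr//|->]; by rewrite rmorph0 root0.
Qed.

(** Two extensions B and L of M embed in a common field, at least after
    replacing L by a finitely generated subfield: the generators are adjoined
    one by one, and E grows accordingly. *)
Lemma finite_amalgamation (L : fieldType) (zs : seq L) (M B : fieldType)
    (j : {rmorphism M -> L}) (b : {rmorphism M -> B}) :
  exists (N : fieldType) (i : {rmorphism M -> N}) (j' : {rmorphism N -> L})
         (E : fieldType) (p : {rmorphism B -> E}) (q : {rmorphism N -> E}),
  [/\ forall m, j' (i m) = j m, forall m, q (i m) = p (b m) &
      forall z, z \in zs -> exists w, j' w = z].
Proof.
elim: zs M B j b => [|z zs IH] M B j b.
  by exists M, idfun, j, B, idfun, b.
have [N [i [j' [w [ji jw lift]]]]] := simple_extension_exists j z.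
have [E [p [y rel_y]]] := extend_relations j z b.
have [q qi qw] := lift _ _ _ rel_y.
have [N1 [i1 [j1 [E1 [p1 [q1 [ji1 qi1 zs1]]]]]]] := IH N E j' q.
exists N1, (i1 \o i), j1, E1, (p1 \o p), q1; split=> [m|m|u] /=.
- by rewrite ji1 ji.
- by rewrite qi1 qi.
rewrite inE => /orP[/eqP->|/zs1//].
by exists (i1 w); rewrite ji1.
Qed.

(** Here perfectness enters.  If x is algebraic its minimal polynomial f is
    separable of degree at least 2, so f/('X - x) has a root different from x in
    some extension.  If x is transcendental, x + 1 satisfies the same (empty)
    set of relations. *)
Lemma separating_extension (K L : fieldType) (iota : {rmorphism K -> L}) (x : L) :
  perfect_field K -> ~ (exists a, iota a = x) ->
  exists (E : fieldType) (p : {rmorphism L -> E}) (y : E),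
    y <> p x /\ same_relations iota x (p \o iota : {rmorphism K -> E}) y.
Proof.
move=> perfK nKx; have [tr|[f irr_f fE]] := minpoly_alternative iota x.
  exists L, idfun, (x + 1); split=> [/eqP|P].
    by rewrite -subr_eq0 addrC addKr oner_eq0.
  apply/idP/idP => [/tr->|]; first by rewrite rmorph0 root0.
  have -> : root (map_poly (idfun \o iota) P) (x + 1) =
            root (map_poly iota (P \Po ('X + 1))) x.
    have x1 : (map_poly iota ('X + 1)).[x] = x + 1.
      by rewrite rmorphD rmorph1 /= map_polyX !hornerE.
    by rewrite map_comp_poly /root horner_comp x1.
  move=> /tr/(congr1 (fun Q => Q \Po ('X - 1))).
  rewrite -comp_polyA comp_polyD comp_polyX -[1]/(1%:P) comp_polyC subrK.
  by rewrite comp_polyXr comp_poly0 => ->; rewrite rmorph0 root0.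
have sep_f := perfK _ irr_f.
have rx : root (map_poly iota f) x by rewrite fE.
have /factor_theorem[g fg] := rx.
have gx : ~~ root g x.
  have: separable_poly (map_poly iota f) by rewrite separable_map.
  by rewrite fg separable_root => /andP[].
have g1 : (1 < size g)%N.
  rewrite ltnNge; apply/negP => g1; apply: nKx.
  have g0 : g != 0.
    apply: contraTneq gx => ->; by rewrite root0.
  have f2 : size f = 2%N.
    rewrite -(size_map_poly iota) fg size_Mmonic ?monicXsubC// size_XsubC addn2.
    by congr _.+1; apply/eqP; rewrite eqn_leq g1 size_poly_gt0.
  have f1 : f`_1 != 0.
    by move: (lead_coef_eq0 f); rewrite lead_coefE f2 -size_poly_eq0 f2 => ->.
  exists (- f`_0 / f`_1); move: rx; rewrite /root horner_coef size_map_poly f2.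
  rewrite big_ord_recl big_ord1 /= !coef_map /= expr0 mulr1 expr1 => /eqP fx.
  rewrite rmorphM fmorphV rmorphN; apply: (canLR (mulfK _)).
    by rewrite fmorph_eq0.
  by apply/eqP; rewrite eq_sym mulrC -addr_eq0 addrC fx.
have [E [p [y ry]]] := root_extension g1.
exists E, p, y; split=> [yx|].
  by move: ry; rewrite yx fmorph_root (negPf gx).
apply: minpoly_relations irr_f fE _.
by rewrite map_poly_comp fg rmorphM rootM ry.
Qed.

(** L itself need not have two embeddings, but the subfield generated by x and
    finitely many prescribed elements does, and this is all that a matrix
    involves. *)
Lemma two_embeddings (K L : fieldType) (iota : {rmorphism K -> L})
    (x : L) (zs : seq L) :
  perfect_field K -> ~ (exists a, iota a = x) ->
  exists (N : fieldType) (i : {rmorphism K -> N}) (j : {rmorphism N -> L})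
         (E : fieldType) (p : {rmorphism L -> E}) (q : {rmorphism N -> E}),
  [/\ forall a, j (i a) = iota a, forall a, q (i a) = p (iota a),
      forall z, z \in zs -> exists w, j w = z &
      exists w, j w = x /\ q w <> p x].
Proof.
move=> perfK nKx.
have [E [p [y [yx rel_y]]]] := separating_extension perfK nKx.
have [N [i [j [w [ji jw lift]]]]] := simple_extension_exists iota x.
have [q qi qw] := lift _ _ _ rel_y.
have [N1 [i1 [j1 [E1 [p1 [q1 [ji1 qi1 zs1]]]]]]] := finite_amalgamation zs j q.
exists N1, (i1 \o i), j1, E1, (p1 \o p), q1; split=> [a|a|//|] /=.
- by rewrite ji1 ji.
- by rewrite qi1 qi.
exists (i1 w); rewrite ji1 jw qi1 qw; split=> //.
by move/fmorph_inj.
Qed.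

(** * Reduction of matrices to monomial form *)

Section Pivoting.
Variables (R : idomainType) (n : nat).
Implicit Types (g a b : 'M[R]_n) (I : {set 'I_n}) (r s : 'I_n -> R).

(** Left multiplication by a column shear adds multiples of row i0 to the rows,
    right multiplication by a row shear adds multiples of column j0 to the
    columns; for r i0 = 0 (resp. s j0 = 0) both are unipotent. *)
Definition col_shear (i0 : 'I_n) r : 'M[R]_n :=
  \matrix_(i, j) ((i == j)%:R + r i * (j == i0)%:R).
Definition row_shear (j0 : 'I_n) s : 'M[R]_n :=
  \matrix_(i, j) ((i == j)%:R + (i == j0)%:R * s j).

Lemma col_shearM i0 r g i j :
  (col_shear i0 r *m g) i j = g i j + r i * g i0 j.
Proof.
rewrite mxE; under eq_bigr do rewrite mxE mulrDl -mulrA; rewrite big_split /=; congr (_ + _).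
  rewrite (bigD1 i)//= eqxx mul1r big1 ?addr0// => k ki.
  by rewrite eq_sym (negPf ki) mul0r.
rewrite (bigD1 i0)//= eqxx mul1r big1 ?addr0// => k ki.
by rewrite (negPf ki) mul0r mulr0.
Qed.

Lemma row_shearM j0 s g i j :
  (g *m row_shear j0 s) i j = g i j + g i j0 * s j.
Proof.
rewrite mxE; under eq_bigr do rewrite mxE mulrDr mulrA; rewrite big_split /=; congr (_ + _).
  rewrite (bigD1 j)//= eqxx mulr1 big1 ?addr0// => k ki.
  by rewrite (negPf ki) mulr0.
rewrite (bigD1 j0)//= eqxx mulr1 big1 ?addr0// => k ki.
by rewrite (negPf ki) mulr0 mul0r.
Qed.

Lemma col_shearN i0 r : r i0 = 0 ->
  col_shear i0 r *m col_shear i0 (fun i => - r i) = 1%:M.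
Proof.
move=> r0; apply/matrixP=> i j; rewrite col_shearM !mxE r0 oppr0 mul0r addr0.
by rewrite (eq_sym j) mulNr addrNK.
Qed.

Lemma row_shearN j0 s : s j0 = 0 ->
  row_shear j0 (fun j => - s j) *m row_shear j0 s = 1%:M.
Proof.
move=> s0; apply/matrixP=> i j; rewrite row_shearM !mxE s0 oppr0 mulr0 addr0.
by rewrite mulrN addrNK.
Qed.

Lemma det_neq0_row g i : \det g != 0 -> exists j, g i j != 0.
Proof.
move=> g0; apply/existsP; apply: contraNT g0 => /existsPn gi0.
rewrite (expand_det_row _ i) big1// => j _.
by have /negPn/eqP-> := gi0 j; rewrite mul0r.
Qed.

Definition monomial_mx g (c : 'I_n -> 'I_n) :=
  injective c /\ forall i j, (g i j != 0) = (j == c i).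

Variables A B : 'M[R]_n -> Prop.
Hypotheses (A1 : A 1%:M) (AM : forall a a', A a -> A a' -> A (a *m a')).
Hypotheses (B1 : B 1%:M) (BM : forall b b', B b -> B b' -> B (b *m b')).
Hypothesis pivot : forall g I i1, i1 \notin I ->
  (forall i, exists j, g i j != 0) ->
  (forall i i' j, i \in I -> i' \notin I -> g i j != 0 -> g i' j = 0) ->
  exists i0 j0 r s,
    [/\ i0 \notin I, g i0 j0 != 0, r i0 = 0 & s j0 = 0] /\
    [/\ A (col_shear i0 r), B (row_shear j0 s),
        forall i, i != i0 -> g i j0 = r i * g i0 j0 &
        forall j, j != j0 -> g i0 j = g i0 j0 * s j].

(** Pivoting is done in place, on the rows and columns not yet reduced: the set
    I of finished rows determines the finished columns.  The choice of pivots,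
    and hence the groups A and B, is left to the [pivot] hypothesis, so that the
    same elimination produces both the Bruhat decomposition (A and B parabolic)
    and the Smith form over F[[t]] (A and B the general linear group). *)
Lemma monomial_factorization g : \det g != 0 ->
  exists a w b, [/\ A a, B b, g = a *m w *m b & exists c, monomial_mx w c].
Proof.
have gen (I : {set 'I_n}) (c : 'I_n -> 'I_n) g1 : \det g1 != 0 ->
    (forall i j, i \in I -> (g1 i j != 0) = (j == c i)) ->
    (forall i l, i \in I -> (g1 l (c i) != 0) = (l == i)) ->
    exists a w b, [/\ A a, B b, g1 = a *m w *m b & exists c, monomial_mx w c].
  have [k] := ubnP #|~: I|; elim: k => // k IH in I c g1 *; rewrite ltnS => Ik.
  move=> g0 rowI colI; have [IT|/forallPn[i1 i1I]] := boolP [forall i, i \in I].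
    have {}IT i : i \in I by apply/forallP.
    exists 1%:M, g1, 1%:M; split=> //; first by rewrite mul1mx mulmx1.
    exists c; split=> [i i' cii'|i j]; last by rewrite rowI.
    by apply/eqP; rewrite eq_sym -colI// cii' colI.
  have [||i0 [j0 [r [s [[i0I gij r0 s0] [Ar Bs gr gs]]]]]] := pivot (g := g1) i1I.
  - by move=> i; apply: det_neq0_row.
  - move=> i i' j iI i'I; rewrite rowI// => /eqP ->; apply/eqP.
    rewrite -[_ == _]negbK colI//; apply: contraNneq i'I => -> //.
  have rI i : i \in I -> r i = 0.
    move=> iI; have ii0 : i != i0 by apply: contraNneq i0I => <-.
    have : g1 i j0 == 0.
      rewrite -[_ == _]negbK rowI//; apply: contraNneq gij => ->.
      by rewrite -[_ == _]negbK colI// eq_sym ii0.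
    by rewrite gr// mulf_eq0 (negPf gij) orbF => /eqP.
  pose g' := col_shear i0 (fun i => - r i) *m g1 *m row_shear j0 (fun j => - s j).
  have g'E i j : g' i j = if i == i0 then if j == j0 then g1 i0 j0 else 0
                          else g1 i j - r i * g1 i0 j.
    rewrite row_shearM !col_shearM.
    have [->|ii0] := eqVneq i i0.
      rewrite r0 oppr0 !mul0r !addr0.
      have [->|jj0] := eqVneq j j0; first by rewrite s0 oppr0 mulr0 addr0.
      by rewrite gs// mulrN addrN.
    by rewrite (gr i)// !mulNr subrr mul0r addr0.
  have gE : g1 = col_shear i0 r *m g' *m row_shear j0 s.
    rewrite /g' !mulmxA col_shearN// mul1mx -mulmxA row_shearN ?mulmx1//.
  have det' : \det g' != 0.
    by apply: contraNneq g0 => g'0; rewrite gE 2!det_mulmx g'0 mulr0 mul0r.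
  have j0c i : i \in I -> (c i == j0) = false.
    move=> iI; apply: contraNF i0I => /eqP ci.
    by move: gij; rewrite -ci colI// => /eqP->.
  have [|||a [w [b [Aa Bb g'w mw]]]] :=
    IH (i0 |: I) (fun i => if i == i0 then j0 else c i) g' _ det'.
  - apply: leq_trans Ik; apply: proper_card; rewrite properE !finset.setCS finset.subsetUr andTb.
    by apply/subsetPn; exists i0; rewrite // in_setU1 eqxx.
  - move=> i j; rewrite in_setU1 g'E.
    have [->//= _|ii0 /= iI] := eqVneq i i0.
      by have [//|] := eqVneq j j0; rewrite eqxx.
    by rewrite rI// mul0r subr0 rowI.
  - move=> i l; rewrite in_setU1 g'E.
    have [->//= _|ii0 /= iI] := eqVneq i i0.
      have [//|ll0] := eqVneq l i0; first by rewrite eqxx gij.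
      by rewrite gr// subrr eqxx.
    rewrite j0c//; have [->|ll0] := eqVneq l i0.
      by rewrite eqxx eq_sym (negPf ii0).
    have /negbFE/eqP -> : (g1 i0 (c i) != 0) = false by rewrite colI// eq_sym (negPf ii0).
    by rewrite mulr0 subr0 colI.
  exists (col_shear i0 r *m a), w, (b *m row_shear j0 s); split=> //.
  - exact: AM. 
  - exact: BM.
  by rewrite gE g'w !mulmxA.
by move=> g0; apply: (gen finset.set0 id) => // i j; rewrite inE.
Qed.

End Pivoting.

(** * Arrays of coefficients and parabolic matrices *)

Section Arrays.
Variable d : nat.

Definition array_index (n : 'I_d -> nat) := {dffun forall i : 'I_d, 'I_(n i)}.

(** The action of a tuple of matrices on the coordinates of a tensor; rectangular
    matrices are allowed so that changes of basis between families of different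
    but equal dimensions need no casts. *)
Definition array_act (S : comNzRingType) (n p : 'I_d -> nat)
    (c : array_index n -> S) (a : forall i, 'M[S]_(n i, p i)) :
    array_index p -> S :=
  fun J => \sum_(f : array_index n) c f * \prod_i a i (f i) (J i).

Lemma array_act1 (S : comNzRingType) (n : 'I_d -> nat) (c : array_index n -> S) :
  array_act c (fun i => 1%:M) = c.
Proof.
apply/funext => J; rewrite /array_act (bigD1 J)//= [X in _ + X]big1 => [|f fJ].
  by rewrite big1 ?addr0 ?mulr1// => i _; rewrite mxE eqxx.
suff [i fi] : exists i, f i != J i.
  by rewrite (bigD1 i)//= mxE (negPf fi) mul0r mulr0.
apply/existsP; rewrite -negb_forall; apply: contra fJ => /forallP fJ.
by apply/eqP; apply/ffunP => i; apply/eqP; apply: fJ.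
Qed.

Lemma array_actM (S : comNzRingType) (n p q : 'I_d -> nat)
    (c : array_index n -> S) (a : forall i, 'M[S]_(n i, p i))
    (b : forall i, 'M[S]_(p i, q i)) :
  array_act (array_act c a) b = array_act c (fun i => a i *m b i).
Proof.
apply/funext => J; rewrite /array_act.
under eq_bigr do rewrite big_distrl /=; rewrite exchange_big /=.
apply: eq_bigr => f _; under eq_bigr do rewrite -mulrA -big_split /=.
rewrite -big_distrr /=; congr (_ * _).
under [in RHS]eq_bigr do rewrite mxE.
by rewrite (bigA_distr_dffun (fun i j => a i (f i) j * b i j (J i))).
Qed.

Lemma array_act_map (S S' : comNzRingType) (phi : {rmorphism S -> S'})
    (n p : 'I_d -> nat) (c : array_index n -> S)
    (a : forall i, 'M[S]_(n i, p i)) J :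
  phi (array_act c a J) = array_act (phi \o c) (fun i => map_mx phi (a i)) J.
Proof.
rewrite rmorph_sum; apply: eq_bigr => f _; rewrite rmorphM rmorph_prod.
by congr (_ * _); apply: eq_bigr => i _; rewrite mxE.
Qed.

Definition array_index_map (n p : 'I_d -> nat) (s : forall i, 'I_(n i) -> 'I_(p i))
  (J : array_index n) : array_index p := [ffun i => s i (J i)].

(** A monomial matrix only permutes and rescales coordinates. *)
Lemma array_act_monomial (S : idomainType) (n : 'I_d -> nat)
    (c : array_index n -> S) (w : forall i, 'M[S]_(n i))
    (s : forall i, 'I_(n i) -> 'I_(n i)) J :
  (forall i, monomial_mx (w i) (s i)) ->
  array_act c w (array_index_map s J) = c J * \prod_i w i (J i) (s i (J i)).
Proof.
move=> mw; rewrite /array_act (bigD1 J)//= [X in _ + X]big1 ?addr0 => [|f fJ].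
  by congr (_ * _); apply: eq_bigr => i _; rewrite ffunE.
suff [i fi] : exists i, f i != J i.
  rewrite (bigD1 i)//= ffunE; have [inj_s /(_ (f i) (s i (J i)))] := mw i.
  by rewrite (inj_eq inj_s) (eq_sym (J i)) (negPf fi) => /negbFE/eqP->; rewrite mul0r mulr0.
apply/existsP; rewrite -negb_forall; apply: contra fJ => /forallP fJ.
by apply/eqP; apply/ffunP => i; apply/eqP; apply: fJ.
Qed.

End Arrays.

Section Parabolic.
Variables (R : realType) (F : fieldType).

(** The k-th column of a *m h is a combination of the columns of a of weight at
    most lam k: these are the matrices preserving the flag that the weights
    define on the columns of a. *)
Definition parabolic (n : nat) (lam : 'I_n -> R) (h : 'M[F]_n) :=
  forall j k, h j k != 0 -> lam j <= lam k.

Definition parabolic_unit (n : nat) (lam : 'I_n -> R) (h : 'M[F]_n) :=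
  [/\ h \in unitmx, parabolic lam h & parabolic lam (invmx h)].

Lemma parabolic1 n (lam : 'I_n -> R) : parabolic lam 1%:M.
Proof. by move=> j k; rewrite mxE; have [->//|] := eqVneq j k; rewrite eqxx. Qed.

Lemma parabolicM n (lam : 'I_n -> R) (g h : 'M[F]_n) :
  parabolic lam g -> parabolic lam h -> parabolic lam (g *m h).
Proof.
move=> pg ph j k; rewrite mxE => gh.
have [l] : exists l, g j l * h l k != 0.
  apply/existsP; apply: contraNT gh => /existsPn gh0; rewrite big1// => l _.
  by have /negPn/eqP := gh0 l.
by rewrite mulf_eq0 negb_or => /andP[/pg jl /ph]; apply: le_trans.
Qed.

Lemma parabolic_unit1 n (lam : 'I_n -> R) : parabolic_unit lam 1%:M.
Proof. by split; rewrite ?unitmx1 ?invmx1//; apply: parabolic1. Qed.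

Lemma parabolic_unitM n (lam : 'I_n -> R) (g h : 'M[F]_n) :
  parabolic_unit lam g -> parabolic_unit lam h -> parabolic_unit lam (g *m h).
Proof.
move=> [ug pg pg'] [uh ph ph'].
have gh1 : (g *m h) *m (invmx h *m invmx g) = 1%:M.
  by rewrite mulmxA -(mulmxA g) mulmxV// mulmx1 mulmxV.
have ugh : g *m h \in unitmx by rewrite unitmx_mul ug uh.
split=> //; first exact: parabolicM.
have -> : invmx (g *m h) = invmx h *m invmx g.
  by rewrite -[RHS]mul1mx -(mulVmx ugh) -mulmxA gh1 mulmx1.
exact: parabolicM.
Qed.

Lemma parabolic_unit_inv n (lam : 'I_n -> R) (g h : 'M[F]_n) :
  g *m h = 1%:M -> parabolic lam g -> parabolic lam h -> parabolic_unit lam g.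
Proof.
move=> gh pg ph; have [ug _] := mulmx1_unit gh; split=> //.
by rewrite -[invmx g]mulmx1 -gh mulKmx.
Qed.

(** Choosing the pivot row of largest weight among the remaining ones, and in it
    a nonzero entry of smallest weight, makes all the shears parabolic. *)
Lemma bruhat n (lam : 'I_n -> R) (g : 'M[F]_n) : g \in unitmx ->
  exists a w b, [/\ parabolic_unit lam a, parabolic_unit lam b,
    g = a *m w *m b & exists c, monomial_mx w c].
Proof.
rewrite unitmxE unitfE; apply: monomial_factorization.
- exact: parabolic_unit1.
- exact: parabolic_unitM.
- exact: parabolic_unit1.
- exact: parabolic_unitM.
move=> {}g I i1 i1I row_g done_g.
pose i0 := [arg max_(i > i1 | i \notin I) lam i]%O.
have [i0I i0max] : i0 \notin I /\ forall i, i \notin I -> lam i <= lam i0.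
  by rewrite /i0; case: Order.TotalTheory.arg_maxP.
have [j1 gj1] := row_g i0.
pose j0 := [arg min_(j < j1 | g i0 j != 0) lam j]%O.
have [gij j0min] : g i0 j0 != 0 /\ forall j, g i0 j != 0 -> lam j0 <= lam j.
  by rewrite /j0; case: Order.TotalTheory.arg_minP.
pose r i := if i == i0 then 0 else g i j0 / g i0 j0.
pose s j := if j == j0 then 0 else g i0 j / g i0 j0.
have r0 : r i0 = 0 by rewrite /r eqxx.
have s0 : s j0 = 0 by rewrite /s eqxx.
have col_par e : (forall i, (e i != 0) = (r i != 0)) -> parabolic lam (col_shear i0 e).
  move=> er i j; rewrite mxE; have [->//|ij] := eqVneq i j.
  rewrite add0r mulf_eq0 negb_or er; have [->|] := eqVneq j i0; last by rewrite eqxx andbF.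
  rewrite oner_neq0 andbT => ri; apply: i0max; apply: contra ri => iI.
  rewrite /r; case: ifP => // _; apply/eqP.
  suff -> : g i j0 = 0 by rewrite mul0r.
  apply/eqP; apply: contraNT gij => gi0; apply/eqP; exact: (done_g i).
have row_par e : (forall i, (e i != 0) = (s i != 0)) -> parabolic lam (row_shear j0 e).
  move=> er i j; rewrite mxE; have [->//|ij] := eqVneq i j.
  rewrite add0r mulf_eq0 negb_or er; have [->|] := eqVneq i j0; last by rewrite eqxx.
  rewrite oner_neq0 andTb /s => sj; apply: j0min; apply: contraNneq sj => ->.
  by rewrite mul0r if_same.
exists i0, j0, r, s; split=> //; split.
- by apply: parabolic_unit_inv (col_shearN r0) _ _; apply: col_par => // i; rewrite oppr_eq0.
- have := @parabolic_unit_inv _ lam (row_shear j0 s) (row_shear j0 (fun j => - s j)).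
  by apply; [exact/mulmx1C/row_shearN|apply: row_par|apply: row_par => i; rewrite oppr_eq0].
- by move=> i /negPf ii0; rewrite /r ii0 divfK.
by move=> j /negPf jj0; rewrite /s jj0 mulrC divfK.
Qed.

End Parabolic.

(** * Descent of a flag *)

Lemma map_mx_preimage (N L : fieldType) (j : {rmorphism N -> L}) m n
    (A : 'M[L]_(m, n)) :
  (forall i k, exists w, j w = A i k) -> exists A', map_mx j A' = A.
Proof.
move=> jA; exists (\matrix_(i, k) projT1 (cid (jA i k))).
by apply/matrixP => i k; rewrite !mxE; case: cid.
Qed.

Definition mx_entries (L : eqType) m n (A : 'M[L]_(m, n)) : seq L :=
  codom (fun x : 'I_m * 'I_n => A x.1 x.2).

Lemma mem_mx_entries (L : eqType) m n (A : 'M[L]_(m, n)) i k :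
  A i k \in mx_entries A.
Proof. exact: (codom_f (fun x : 'I_m * 'I_n => A x.1 x.2) (i, k)). Qed.

(** Normalizing a basis of the row space W to be the identity on some full set
    of columns makes it unique.  The entries of this reduced basis are thus
    fixed by all pairs of embeddings that agree on W, hence lie in K. *)
Lemma row_space_descent (K L : fieldType) (iota : {rmorphism K -> L}) m n
    (W : 'M[L]_(m, n)) (zs : seq L) :
  perfect_field K ->
  (forall (N : fieldType) (i : {rmorphism K -> N}) (j : {rmorphism N -> L})
          (E : fieldType) (p : {rmorphism L -> E}) (q : {rmorphism N -> E}),
    (forall a, j (i a) = iota a) -> (forall a, q (i a) = p (iota a)) ->
    (forall z, z \in zs -> exists w, j w = z) ->
    forall W', map_mx j W' = W -> (map_mx q W' :=: map_mx p W)%MS) ->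
  exists B : 'M[K]_(\rank W, n), (map_mx iota B :=: W)%MS.
Proof.
move=> perfK inv.
have fullW : row_full (row_base W)^T.
  by rewrite /row_full mxrank_tr -/(row_free _) row_base_free.
(* f lists columns on which the basis of W restricts to an invertible X. *)
pose f := fullrankfun fullW.
pose X := colsub f (row_base W).
have uX : X \in unitmx.
  by rewrite -unitmx_tr trmx_mxsub fullrowsub_unit.
pose A := invmx X *m row_base W.
have AW : (A :=: W)%MS.
  apply: eqmx_trans (eq_row_base W).
  by apply: eqmxMfull; rewrite row_full_unit unitmx_inv.
have fA : colsub f A = 1%:M by rewrite -mulmx_colsub mulVmx.
have [inK|] := pselect (forall i k, exists b, iota b = A i k).
  by have [B BA] := map_mx_preimage inK; exists B; rewrite BA.
move=> /existsNP[i0 /existsNP[k0 nKx]].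
have [N [i [j [E [p [q [ji qi zsj [w [jw []]]]]]]]]] :=
  two_embeddings (zs ++ mx_entries W ++ mx_entries A) perfK nKx.
have [|W' jW'] := @map_mx_preimage _ _ j _ _ W.
  by move=> l k; apply: zsj; rewrite !mem_cat mem_mx_entries orbT.
have [|A' jA'] := @map_mx_preimage _ _ j _ _ A.
  by move=> l k; apply: zsj; rewrite !mem_cat mem_mx_entries !orbT.
have AW' : (A' :=: W')%MS.
  by apply/eqmxP; rewrite -!(map_submx j) jA' jW'; apply/eqmxP.
have fA' : colsub f A' = 1%:M.
  by apply: (@map_mx_inj _ _ j); rewrite map_mxsub jA' fA map_mx1.
have zsj' z : z \in zs -> exists w, j w = z.
  by move=> zzs; apply: zsj; rewrite mem_cat zzs.
have qpA : (map_mx q A' <= map_mx p A)%MS.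
  have -> : (map_mx p A :=: map_mx p W)%MS.
    by apply/eqmxP; rewrite !map_submx; apply/eqmxP.
  have <- := inv N i j E p q ji qi zsj' W' jW'.
  by rewrite map_submx AW'.
have /submxP[Y qY] := qpA.
have Y1 : Y = 1%:M.
  have := congr1 (colsub f) qY; rewrite -mulmx_colsub -!map_mxsub fA fA'.
  by rewrite !map_mx1 mulmx1.
have <- : A' i0 k0 = w.
  by apply: (fmorph_inj j); rewrite jw -jA' mxE.
by move/matrixP/(_ i0 k0): qY; rewrite Y1 mul1mx !mxE.
Qed.

Lemma rank_leq_support (F : fieldType) m n (T : {set 'I_m}) (A : 'M[F]_(m, n)) :
  (forall k, k \notin T -> row k A = 0) -> (\rank A <= #|T|)%N.
Proof.
move=> AT; apply: leq_trans (rank_leq_row (rowsub (@enum_val _ (mem T)) A)).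
apply/mxrankS/row_subP => k; have [kT|/AT->] := boolP (k \in T); last exact: sub0mx.
have := row_sub (enum_rank_in kT k) (rowsub (@enum_val _ (mem T)) A).
by rewrite row_rowsub enum_rankK_in.
Qed.

Section AdaptedBasis.
Variable (R : realType).

(** The rows are chosen greedily by increasing weight: when row k is chosen, the
    previous ones are among those of weight at most lam k, hence too few to
    span B k. *)
Lemma adapted_basis_exists (F : fieldType) n (lam : 'I_n -> R) (B : 'I_n -> 'M[F]_n) :
  (forall k, (#|[set j | (lam j <= lam k)%R]%SET| <= \rank (B k))%N) ->
  exists2 a : 'M[F]_n, a \in unitmx & forall k, (row k a <= B k)%MS.
Proof.
move=> rB.
have gen s : (s <= n)%N -> exists (T : {set 'I_n}) (a : 'M[F]_n),
    [/\ #|T| = s, forall i j, j \in T -> lam i < lam j -> i \in T,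
        forall k, (row k a <= B k)%MS, forall k, k \notin T -> row k a = 0 &
        (s <= \rank a)%N].
  elim: s => [_|s IH sn].
    exists finset.set0, 0; rewrite cards0; split=> // [i j|k|k _].
    - by rewrite inE.
    - by rewrite row0 sub0mx.
    - by rewrite row0.
  have [T [a [Ts closedT aB aT ra]]] := IH (ltnW sn).
  have /subsetPn[k1 _ k1T] : ~~ ([set: 'I_n]%SET \subset T).
    apply/negP => /subset_leq_card; rewrite cardsT card_ord Ts.
    by rewrite leqNgt sn.
  pose k := [arg min_(k < k1 | k \notin T) lam k]%O.
  have [kT kmin] : k \notin T /\ forall l, l \notin T -> lam k <= lam l.
    by rewrite /k; case: Order.TotalTheory.arg_minP.
  (* The chosen rows T, together with k, have weight at most lam k. *)
  have /row_subPn[l nBa] : ~~ (B k <= a)%MS.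
    apply/negP => /mxrankS; rewrite leqNgt; case/negP.
    apply: leq_trans (rB k); apply: leq_ltn_trans (rank_leq_support aT) _.
    apply: (@leq_trans #|k |: T|); first by rewrite cardsU1 kT.
    apply/subset_leq_card/fintype.subsetP => j.
    rewrite in_setU1 inE => /orP[/eqP->//|jT].
    by rewrite leNgt; apply: contra kT; apply: closedT.
  pose a' := \matrix_i (if i == k then row l (B k) else row i a).
  have a'E i : row i a' = if i == k then row l (B k) else row i a by exact: rowK.
  exists (k |: T), a'; split.
  - by rewrite cardsU1 kT Ts.
  - move=> i j; rewrite !in_setU1 => /orP[/eqP->|jT] ij; apply/orP; right.
      by apply: contraTT ij => /kmin; rewrite -leNgt.
    exact: closedT ij.
  - by move=> i; rewrite a'E; case: eqP => [->|_]; rewrite ?row_sub ?aB.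
  - move=> i; rewrite in_setU1 negb_or => /andP[ik iT].
    by rewrite a'E (negPf ik) aT.
  apply: leq_ltn_trans ra _; apply: rank_ltmx; rewrite ltmxE; apply/andP; split.
    apply/row_subP => i; have [->|ik] := eqVneq i k; first by rewrite aT ?sub0mx.
    by have := row_sub i a'; rewrite a'E (negPf ik).
  apply: contra nBa => /row_subP/(_ k); by rewrite a'E eqxx.
have [T [a [_ _ aB _ ra]]] := gen n (leqnn n).
exists a => //; rewrite -row_full_unit /row_full eqn_leq ra andbT.
exact: rank_leq_row.
Qed.

(** The space of vectors of weight at most lam k is spanned by the corresponding
    columns of a; written as the row space of a masked transpose, it descends to
    K, and a basis adapted to the descended flag differs from a by a parabolic
    matrix. *)
Lemma flag_basis_descent (K L : fieldType) (iota : {rmorphism K -> L}) n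
    (lam : 'I_n -> R) (a : 'M[L]_n) (zs : seq L) :
  perfect_field K -> a \in unitmx ->
  (forall (N : fieldType) (i : {rmorphism K -> N}) (j : {rmorphism N -> L})
          (E : fieldType) (p : {rmorphism L -> E}) (q : {rmorphism N -> E}),
    (forall a, j (i a) = iota a) -> (forall a, q (i a) = p (iota a)) ->
    (forall z, z \in zs -> exists w, j w = z) ->
    forall a', map_mx j a' = a ->
    parabolic lam (invmx (map_mx p a) *m map_mx q a')) ->
  exists2 b : 'M[K]_n, b \in unitmx & parabolic lam (invmx a *m map_mx iota b).
Proof.
move=> perfK ua inv.
pose mask (F : fieldType) k : 'M[F]_n :=
  diag_mx (\row_j (lam j <= lam k)%R%:R).
pose W k := mask L k *m a^T.
have maskE (F : fieldType) k m (A : 'M[F]_(n, m)) i j :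
    (mask F k *m A) i j = (lam i <= lam k)%R%:R * A i j.
  by rewrite mul_diag_mx !mxE.
have map_mask (F E : fieldType) (f : {rmorphism F -> E}) k :
    map_mx f (mask F k) = mask E k.
  rewrite map_diag_mx; congr diag_mx; apply/rowP => j.
  by rewrite !mxE rmorph_nat.
have rW k : (#|[set j | (lam j <= lam k)%R]%SET| <= \rank (W k))%N.
  pose T := [set j | (lam j <= lam k)%R]%SET.
  have: (n <= \rank (W k + (a^T - W k))%R)%N.
    by rewrite addrC subrK mxrank_tr mxrank_unit.
  move=> /leq_trans/(_ (mxrank_add _ _)).
  have : (\rank (a^T - W k)%R <= #|~: T|)%N.
    apply: rank_leq_support => i; rewrite !inE negbK => ik.
    apply/rowP => j; rewrite 2!mxE [X in _ + X]mxE maskE ik mul1r !mxE.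
    by rewrite subrr.
  rewrite cardsCs finset.setCK card_ord => h1.
  move=> /leq_trans/(_ (leq_add (leqnn _) h1)).
  by rewrite addnC -leq_subLR subKn// -[X in (_ <= X)%N]card_ord max_card.
have desc k : exists B : 'M[K]_n, (map_mx iota B :=: W k)%MS.
  have [|B BW] := @row_space_descent _ _ iota _ _ (W k) (zs ++ mx_entries a) perfK.
    move=> N i j E p q ji qi zsj W' jW'.
    have [|a' ja'] := @map_mx_preimage _ _ j _ _ a.
      by move=> l m; apply: zsj; rewrite mem_cat mem_mx_entries orbT.
    have W'E : W' = mask N k *m a'^T.
      by apply: (@map_mx_inj _ _ j); rewrite jW' map_mxM map_mask -map_trmx ja'.
    have [x [px qa']] : exists x, parabolic lam x /\ map_mx q a' = map_mx p a *m x.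
      exists (invmx (map_mx p a) *m map_mx q a').
      rewrite mulKVmx ?map_unitmx//; split=> //.
      by apply: (inv N i) => // z zzs; apply: zsj; rewrite mem_cat zzs.
    (* A row of x^T of weight at most lam k only involves columns of weight at
       most lam k, so masking it again on the right changes nothing. *)
    have mx : mask E k *m x^T = mask E k *m x^T *m mask E k.
      apply/matrixP => l m; rewrite [RHS]mxE (bigD1 m)//= big1 ?addr0 => [|o om].
        rewrite !maskE !mxE eqxx mulr1n; have [lk|] := leP (lam l) (lam k); last by rewrite !mul0r.
        rewrite !mul1r; have [->|/px ml] := eqVneq (x m l) 0; first by rewrite mul0r.
        by rewrite (le_trans ml lk) mulr1.
      by rewrite [mask E k o m]mxE (negPf om) mulr0n mulr0.
    have qpW : (map_mx q W' <= map_mx p (W k))%MS.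
      rewrite W'E /W !map_mxM !map_mask -!map_trmx qa' trmx_mul mulmxA mx -mulmxA.
      exact: submxMl.
    apply/eqmxP; rewrite qpW/= -(geq_leqif (mxrank_leqif_sup qpW)).
    by rewrite !mxrank_map -jW' mxrank_map.
  exists (<<B>>)%MS; apply: eqmx_trans BW; apply: eqmx_trans (map_genmx _ _) _.
  exact: genmxE.
pose B k := projT1 (cid (desc k)).
have BW k : (map_mx iota (B k) :=: W k)%MS by rewrite /B; case: cid.
have [|b ub bB] := @adapted_basis_exists K n lam B.
  by move=> k; rewrite -(mxrank_map iota) BW.
exists b^T; first by rewrite unitmx_tr.
move=> l k; have := bB k; rewrite -(map_submx iota) BW => /submxP[Y bY].
have -> : (invmx a *m map_mx iota b^T) l k = Y 0 l * (lam l <= lam k)%R%:R.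
  rewrite -[invmx a *m _]trmxK trmx_mul map_trmx trmxK mxE.
  transitivity ((Y *m mask L k) 0 l); last first.
    by rewrite mul_mx_diag !mxE.
  rewrite -[RHS]/(((_ : 'rV_n) : 'rV_n) 0 l).
  have -> : Y *m mask L k = map_mx iota (row k b) *m (invmx a)^T.
    by rewrite bY /W -!mulmxA -trmx_mul mulVmx// trmx1 mulmx1.
  by rewrite map_row -row_mul [RHS]mxE mxE.
by have [//|_] := leP (lam l) (lam k); rewrite mulr0 eqxx.
Qed.
End AdaptedBasis.

(** * Weights on a fixed support *)

Section Maximum.
Variables (R : realType).

Lemma unit_box_max N (f : 'rV[R]_N -> R) (I : Type) (g : I -> 'rV[R]_N -> R) :
  continuous f -> (forall i, continuous (g i)) ->
  let feasible (x : 'rV[R]_N) := (forall k, 0 <= x 0 k <= 1) /\ (forall i, 0 <= g i x) in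
  (exists x, feasible x) ->
  exists x, feasible x /\ forall y, feasible y -> f y <= f x.
Proof.
move=> cf cg feasible [x0 fx0].
pose A : set 'rV[R]_N := [set x | feasible x]%classic.
have cA : compact A.
  have -> : A = ([set x : 'rV[R]_N | forall k, `[0, 1]%classic (x ord0 k)] `&`
                \bigcap_(i in [set: I]) (g i @^-1` [set y | 0 <= y]))%classic.
    apply/seteqP; split=> x.
      move=> [bx gx]; split=> [k|i _]; last exact: gx.
      by rewrite /= in_itv /= bx.
    move=> [bx gx]; split=> [k|i]; last exact: gx.
    by have := bx k; rewrite /= in_itv.
  apply: compact_closedI.
    apply: (@rV_compact R N (fun=> `[0, 1]%classic)) => k.
    exact: segment_compact.
  apply: closed_bigI => i _; apply: preimage_closed; last exact: closed_ge.
  by move=> x _; apply: cg.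
have [||c cA' cmax] := EVT_max_rV (f := f) _ cA.
- by exists x0.
- exact: continuous_subspaceT.
exists c; split; first by move: cA'; rewrite inE.
by move=> y fy; apply: cmax; rewrite inE.
Qed.

Lemma continuous_sum (T : topologicalType) (I : Type) (s : seq I) (f : I -> T -> R) :
  (forall i, continuous (f i)) -> continuous (fun x => \sum_(i <- s) f i x).
Proof. by move=> cf; apply: continuous_big => //; exact: add_continuous. Qed.

Lemma continuous_mul (T : topologicalType) (f g : T -> R) :
  continuous f -> continuous g -> continuous (fun x => f x * g x).
Proof. by move=> cf cg x; apply: cvgM; [exact: cf|exact: cg]. Qed.

Lemma continuous_sub (T : topologicalType) (f g : T -> R) :
  continuous f -> continuous g -> continuous (fun x => f x - g x).
Proof. by move=> cf cg x; apply: cvgB; [exact: cf|exact: cg]. Qed.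

End Maximum.

Section WeightedSupports.
Variables (R : realType) (d : nat) (n : 'I_d -> nat) (alpha : 'I_d -> R) (r : R).

Definition weighting := forall i, 'I_(n i) -> R.
Implicit Types (lam mu : weighting) (m : R) (S : {set array_index n}).

Definition weight_of lam (J : array_index n) := \sum_i lam i (J i).

Definition supported (F : fieldType) (c : array_index n -> F) lam m :=
  forall J, c J != 0 -> m <= weight_of lam J.

Definition weight_cost lam := \sum_i alpha i * \sum_j lam i j.
Definition weight_norm lam := \sum_i \sum_j lam i j ^+ 2.
(** The first two terms are linear in (lam, m), and positive when the weighted
    basis witnesses rk < r.  The quadratic penalty makes the function strictly
    concave in lam and is negligible for small weights, so that it does not
    affect the existence of positive values. *)
Definition instability lam m := r * m - weight_cost lam - weight_norm lam.
(** Restricting to a cube gives compactness; by homogeneity every witness can be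
    scaled into it. *)
Definition unit_weights lam m :=
  (forall i j, 0 <= lam i j <= 1) /\ 0 <= m <= 1.

(** The bound m is kept as a variable instead of the minimum of the weights on S:
    the constraints are then closed and affine, and an empty S causes no
    trouble. *)
Lemma instability_max S : exists lam m,
  [/\ unit_weights lam m, forall J, J \in S -> m <= weight_of lam J &
    forall mu m', unit_weights mu m' ->
      (forall J, J \in S -> m' <= weight_of mu J) ->
      instability mu m' <= instability lam m].
Proof.
pose T := {i : 'I_d & 'I_(n i)}.
(* Coordinate 0 of x is the bound m, the others are the weights. *)
pose wt (x : 'rV[R]_(#|{: T}|.+1)) : weighting :=
  fun i j => x 0 (lift ord0 (enum_rank (Tagged (fun i => 'I_(n i)) j : T))).
pose f x := instability (wt x) (x 0 ord0).
pose g (J : {J | J \in S}) x := weight_of (wt x) (val J) - x 0 ord0.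
have c_wt i j : continuous (fun x => wt x i j) by apply: coord_continuous.
have cf : continuous f.
  have c0 : continuous (fun x : 'rV[R]_(#|{: T}|.+1) => x 0 ord0) by exact: coord_continuous.
  have c1 : continuous (fun x => weight_cost (wt x)).
    apply: (@continuous_sum R _ _ _ (fun i x => alpha i * \sum_j wt x i j)) => i.
    apply: (@continuous_mul R _ (fun=> alpha i) (fun x => \sum_j wt x i j)).
      exact: cst_continuous.
    by apply: (@continuous_sum R _ _ _ (fun j x => wt x i j)) => j; apply: c_wt.
  have c2 : continuous (fun x => weight_norm (wt x)).
    apply: (@continuous_sum R _ _ _ (fun i x => \sum_j wt x i j ^+ 2)) => i.
    apply: (@continuous_sum R _ _ _ (fun j x => wt x i j ^+ 2)) => j.
    by apply: (@continuous_mul R _ (fun x => wt x i j) (fun x => wt x i j)); apply: c_wt.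
  have cr : continuous (fun _ : 'rV[R]_(#|{: T}|.+1) => r) by exact: cst_continuous.
  exact: (continuous_sub (continuous_sub (continuous_mul cr c0) c1) c2).
have cg J : continuous (g J).
  apply: (@continuous_sub R _ (fun x => weight_of (wt x) (val J))
    (fun x => x 0 ord0)); last exact: coord_continuous.
  by apply: (@continuous_sum R _ _ _ (fun i x => wt x i (val J i))) => i; apply: c_wt.
have [|x [[bx gx] xmax]] := unit_box_max cf cg.
  exists 0; split=> [k|J]; first by rewrite mxE lexx ler01.
  rewrite /g mxE subr0; apply: sumr_ge0 => i _; by rewrite /wt mxE.
exists (wt x), (x 0 ord0); split.
- by split=> [i j|]; apply: bx.
- by move=> J JS; have := gx (exist _ J JS); rewrite subr_ge0.
move=> mu m' [bmu bm'] Smu.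
pose y : 'rV[R]_(#|{: T}|.+1) := \row_k
  if unlift ord0 k is Some t then mu (tag (enum_val t)) (tagged (enum_val t)) else m'.
have y0 : y 0 ord0 = m' by rewrite mxE unlift_none.
have wy : wt y = mu.
  apply: functional_extensionality_dep => i; apply/funext => j.
  by rewrite /wt mxE liftK enum_rankK.
have := xmax y; rewrite /f y0 wy; apply; split=> [k|[J JS]].
  by rewrite mxE; case: unliftP => [t|] _; [apply: bmu|apply: bm'].
by rewrite /g y0 wy subr_ge0 Smu.
Qed.

(** Permuting the weights changes neither the cost nor the norm, so by the
    parallelogram identity the midpoint gains a quarter of the squared distance
    between the two weightings. *)
Lemma permuted_midpoint lam m (s : forall i, 'I_(n i) -> 'I_(n i)) :
  (forall i, injective (s i)) ->
  instability (fun i j => (lam i j + lam i (s i j)) / 2) m <= instability lam m ->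
  forall i j, lam i (s i j) = lam i j.
Proof.
move=> inj_s.
have sumE (h : forall i, 'I_(n i) -> R) i : \sum_j h i (s i j) = \sum_j h i j.
  by rewrite [RHS](reindex_inj (inj_s i)).
rewrite /instability.
have -> : weight_cost (fun i j => (lam i j + lam i (s i j)) / 2) = weight_cost lam.
  apply: eq_bigr => i _; congr (_ * _).
  rewrite -big_distrl big_split /= sumE; set x := \sum_j lam i j.
  by lra.
rewrite lerD2l lerN2.
have -> : weight_norm lam = weight_norm (fun i j => (lam i j + lam i (s i j)) / 2)
    + \sum_i \sum_j ((lam i j - lam i (s i j)) / 2) ^+ 2.
  rewrite -big_split; apply: eq_bigr => i _; rewrite -big_split /=.
  transitivity (\sum_j (lam i j ^+ 2 + lam i (s i j) ^+ 2) / 2).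
    rewrite -big_distrl big_split /= (sumE (fun i j => lam i j ^+ 2)).
    by set x := \sum_j _; lra.
  by apply: eq_bigr => j _; field.
rewrite gerDl => sum_le0 i j.
have sq_ge0 k l : 0 <= ((lam k l - lam k (s k l)) / 2) ^+ 2 by exact: sqr_ge0.
have: \sum_i \sum_j ((lam i j - lam i (s i j)) / 2) ^+ 2 == 0.
  by rewrite eq_le sum_le0 sumr_ge0// => k _; apply: sumr_ge0.
rewrite psumr_eq0 => [/allP/(_ i (mem_index_enum _))|k _]; last exact: sumr_ge0.
rewrite psumr_eq0// => /allP/(_ j (mem_index_enum _)) /=.
by rewrite sqrf_eq0 => /eqP; lra.
Qed.
End WeightedSupports.

(** * Descent of the optimal weighted bases *)

Lemma supported_parabolic (R : realType) (F : fieldType) d (n : 'I_d -> nat)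
    (c : array_index n -> F) (h : forall i, 'M[F]_(n i))
    (lam : weighting R n) (m : R) :
  (forall i, parabolic (lam i) (h i)) -> supported c lam m ->
  supported (array_act c h) lam m.
Proof.
move=> ph cm J; rewrite /array_act => cJ.
have [f] : exists f, c f * \prod_i h i (f i) (J i) != 0.
  apply/existsP; apply: contraNT cJ => /existsPn cf0; rewrite big1// => f _.
  by have /negPn/eqP := cf0 f.
rewrite mulf_eq0 negb_or prodf_seq_neq0 => /andP[/cm cf /allP hf].
apply: le_trans cf _; apply: ler_sum => i _.
by apply: ph; apply: hf; rewrite mem_index_enum.
Qed.

Section Realizable.
Variables (d : nat) (n : 'I_d -> nat).

Definition realizable (F : fieldType) (c : array_index n -> F)
    (S : {set array_index n}) :=
  exists a : forall i, 'M[F]_(n i), (forall i, a i \in unitmx) /\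
    forall J, (J \in S) = (array_act c a J != 0).

Lemma array_act_support_map (F E : fieldType) (phi : {rmorphism F -> E})
    (c : array_index n -> F) (a : forall i, 'M[F]_(n i)) J :
  (array_act (phi \o c) (fun i => map_mx phi (a i)) J != 0) =
  (array_act c a J != 0).
Proof. by rewrite -array_act_map fmorph_eq0. Qed.

Lemma realizable_map (F E : fieldType) (phi : {rmorphism F -> E})
    (c : array_index n -> F) S :
  realizable c S -> realizable (phi \o c) S.
Proof.
move=> [a [ua aS]]; exists (fun i => map_mx phi (a i)).
by split=> [i|J]; [rewrite map_unitmx|rewrite array_act_support_map].
Qed.

(** The realizable supports increase with the field and are finite in number, so
    some extension realizes as many of them as possible. *)
Lemma maximal_extension (L : fieldType) (c : array_index n -> L) :
  exists (M : fieldType) (k : {rmorphism L -> M}),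
    forall (E : fieldType) (p : {rmorphism M -> E}) S,
      realizable (p \o (k \o c)) S -> realizable (k \o c) S.
Proof.
pose sups (M : fieldType) (k : {rmorphism L -> M}) :=
  [set S | `[< realizable (k \o c) S >]]%SET.
pose Q N := `[< exists (M : fieldType) (k : {rmorphism L -> M}), #|sups M k| = N >].
have exQ : exists N, Q N.
  by exists #|sups L idfun|; apply/asboolP; exists L, idfun.
have bQ N : Q N -> (N <= #|{set array_index n}|)%N.
  by move=> /asboolP[M [k <-]]; apply: max_card.
case: (ex_maxnP exQ bQ) => _ /asboolP[M [k <-]] maxM.
exists M, k => E p S rS.
(* By maximality of their number, E has the same supports as M. *)
have sub : sups M k \subset sups E (p \o k).
  apply/fintype.subsetP => S'; rewrite !finset.in_set => /asboolP rS'; apply/asboolP.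
  exact: (realizable_map p rS').
have /eqP supsE : sups M k == sups E (p \o k).
  rewrite eqEcard sub maxM//; apply/asboolP; by exists E, (p \o k).
suff : S \in sups M k by rewrite finset.in_set => /asboolP.
by rewrite supsE finset.in_set; apply/asboolP.
Qed.

End Realizable.

Section Kempf.
Variables (R : realType) (d : nat) (n : 'I_d -> nat) (alpha : 'I_d -> R) (r : R).

Local Notation instability := (instability alpha r).

Definition real_destabilized (F : fieldType) (c : array_index n -> F) :=
  exists (a : forall i, 'M[F]_(n i)) (lam : weighting R n) (m : R),
    [/\ forall i, a i \in unitmx, unit_weights lam m,
        supported (array_act c a) lam m & 0 < instability lam m].

(** Kempf's uniqueness.  Writing a^-1 b = A w B with A, B parabolic and w
    monomial, the basis e = a A is compatible both with the weights lam (through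
    a) and with the permuted weights (through b = e w B).  Optimality forces the
    permutation to preserve the weights, so that w is itself parabolic. *)
Lemma optimal_parabolic (E : fieldType) (c : array_index n -> E)
    (a b : forall i, 'M[E]_(n i)) (lam : weighting R n) m :
  (forall i, a i \in unitmx) -> (forall i, b i \in unitmx) ->
  unit_weights lam m ->
  supported (array_act c a) lam m -> supported (array_act c b) lam m ->
  (forall (e : forall i, 'M[E]_(n i)) (mu : weighting R n),
     (forall i, e i \in unitmx) -> unit_weights mu m ->
     supported (array_act c e) mu m -> instability mu m <= instability lam m) ->
  forall i, parabolic (lam i) (invmx (a i) *m b i).
Proof.
move=> ua ub ulam sa sb opt.
pose P i (t : 'M[E]_(n i) * 'M[E]_(n i) * 'M[E]_(n i) * ('I_(n i) -> 'I_(n i))) :=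
  [/\ parabolic_unit (lam i) t.1.1.1, parabolic_unit (lam i) t.1.2,
    invmx (a i) *m b i = t.1.1.1 *m t.1.1.2 *m t.1.2 & monomial_mx t.1.1.2 t.2].
have exP i : exists t, P i t.
  have [|A [w [B [pA pB abE [s mw]]]]] := @bruhat R E _ (lam i) (invmx (a i) *m b i).
    by rewrite unitmx_mul unitmx_inv ua ub.
  by exists (A, w, B, s).
pose t i := projT1 (cid (exP i)).
have Pt i : P i (t i) by rewrite /t; case: cid.
pose A i := (t i).1.1.1; pose w i := (t i).1.1.2; pose B i := (t i).1.2.
pose s i := (t i).2.
have pA i : parabolic_unit (lam i) (A i) by case: (Pt i).
have pB i : parabolic_unit (lam i) (B i) by case: (Pt i).
have abE i : invmx (a i) *m b i = A i *m w i *m B i by case: (Pt i).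
have mw i : monomial_mx (w i) (s i) by case: (Pt i).
pose e i := a i *m A i.
have ue i : e i \in unitmx by rewrite unitmx_mul ua; case: (pA i).
have se : supported (array_act c e) lam m.
  rewrite /e -array_actM; apply: supported_parabolic sa => i; by case: (pA i).
have sew : supported (array_act c (fun i => e i *m w i)) lam m.
  have -> : (fun i => e i *m w i) = (fun i => b i *m invmx (B i)).
    apply: functional_extensionality_dep => i.
    have [uB _ _] := pB i.
    by rewrite -[b i](mulKVmx (ua i)) abE !mulmxA mulmxK.
  rewrite -array_actM; apply: supported_parabolic sb => i; by case: (pB i).
(* The coordinates of b B^-1 = e w are those of e, permuted by s and rescaled. *)
have sel : supported (array_act c e) (fun i j => lam i (s i j)) m.
  move=> J cJ; have := sew (array_index_map s J).
  rewrite -array_actM (array_act_monomial _ _ mw) mulf_neq0//.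
    move=> /(_ isT); rewrite /weight_of.
    by under eq_bigr do rewrite ffunE.
  by apply/prodf_neq0 => i _; have [_ ->] := mw i.
have lam_s i j : lam i (s i j) = lam i j.
  apply: (permuted_midpoint (alpha := alpha) (r := r) (m := m)) => [k|].
    by have [] := mw k.
  have [bl bm] := ulam.
  apply: (opt e) => //.
    split=> // k l; have /andP[? ?] := bl k l; have /andP[? ?] := bl k (s k l).
    by apply/andP; split; lra.
  move=> J cJ; have := se J cJ; have := sel J cJ; rewrite /weight_of => h1 h2.
  by rewrite -big_distrl big_split /=; lra.
move=> i; rewrite abE; apply: parabolicM; last by case: (pB i).
apply: parabolicM; first by case: (pA i).
by move=> j k; have [_ ->] := mw i => /eqP->; rewrite lam_s.
Qed.

(** Over the maximal extension M the optimum a stays optimal in every extension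
    of M, so two embeddings p, q of a field containing its entries give parabolic
    (p a)^-1 (q a), which is what the descent of the flag requires. *)
Lemma real_destabilized_descent (K L : fieldType) (iota : {rmorphism K -> L})
    (c : array_index n -> K) :
  perfect_field K -> real_destabilized (iota \o c) -> real_destabilized c.
Proof.
move=> perfK [a0 [lam0 [m0 [ua0 ulam0 sa0 ins0]]]].
have [M [k maxM]] := maximal_extension (iota \o c).
pose iM : {rmorphism K -> M} := k \o iota.
pose cM : array_index n -> M := iM \o c.
pose good S := `[< realizable cM S >].
have [S0 goodS0 sS0] : exists2 S0, good S0 & forall J, J \in S0 -> m0 <= weight_of lam0 J.
  exists [set J | array_act (iota \o c) a0 J != 0]%SET => [|J]; last first.
    by rewrite finset.in_set; apply: sa0.
  apply/asboolP/(realizable_map k); exists a0; split=> // J; by rewrite finset.in_set.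
pose opt (S : {set array_index n}) (t : weighting R n * R) :=
  [/\ unit_weights t.1 t.2, forall J, J \in S -> t.2 <= weight_of t.1 J &
    forall mu m', unit_weights mu m' ->
      (forall J, J \in S -> m' <= weight_of mu J) ->
      instability mu m' <= instability t.1 t.2].
have exopt S : exists t, opt S t.
  by have [lam [m H]] := instability_max alpha r S; exists (lam, m).
pose best S := projT1 (cid (exopt S)).
have bestP S : opt S (best S) by rewrite /best; case: cid.
pose S := [arg max_(S > S0 | good S) instability (best S).1 (best S).2]%O.
have [goodS Smax] : good S /\ forall S', good S' ->
    instability (best S').1 (best S').2 <= instability (best S).1 (best S).2.
  by rewrite /S; case: Order.TotalTheory.arg_maxP.
pose lam := (best S).1; pose m := (best S).2.
have [ulam sS _] := bestP S.
have /asboolP[a [ua aS]] := goodS.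
have sa : supported (array_act cM a) lam m by move=> J; rewrite -aS; apply: sS.
have ins : 0 < instability lam m.
  apply: lt_le_trans ins0 _; apply: le_trans (Smax _ goodS0).
  by have [_ _] := bestP S0; apply.
have optE (E : fieldType) (p : {rmorphism M -> E}) (e : forall i, 'M[E]_(n i))
    (mu : weighting R n) : (forall i, e i \in unitmx) -> unit_weights mu m ->
     supported (array_act (p \o cM) e) mu m -> instability mu m <= instability lam m.
  move=> ue umu se; pose S' := [set J | array_act (p \o cM) e J != 0]%SET.
  have goodS' : good S'.
    apply/asboolP/(maxM E p); exists e; split=> // J; by rewrite finset.in_set.
  apply: le_trans (Smax _ goodS'); have [_ _] := bestP S'; apply=> // J.
  by rewrite finset.in_set; apply: se.
have descent i : exists2 b : 'M[K]_(n i), b \in unitmx &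
    parabolic (lam i) (invmx (a i) *m map_mx iM b).
  pose zs := flatten [seq mx_entries (a i) | i <- enum 'I_d].
  apply: (@flag_basis_descent R K M iM _ (lam i) (a i) zs) => //.
  move=> N i1 j E p q ji qi zsj a' ja'.
  have lift_a l : exists b : 'M[N]_(n l), map_mx j b = a l.
    apply: map_mx_preimage => x y; apply: zsj; apply/flattenP.
    exists (mx_entries (a l)); last exact: mem_mx_entries.
    by apply/mapP; exists l; rewrite ?mem_enum.
  pose b l := projT1 (cid (lift_a l)).
  have jb l : map_mx j (b l) = a l by rewrite /b; case: cid.
  have -> : a' = b i by apply: (@map_mx_inj _ _ j); rewrite jb.
  have cE : q \o (i1 \o c) = p \o cM by apply/funext => J; rewrite /= qi.
  have cj : j \o (i1 \o c) = cM by apply/funext => J; rewrite /= ji.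
  apply: (@optimal_parabolic E (p \o cM) (fun l => map_mx p (a l))
    (fun l => map_mx q (b l)) lam m) => //.
  - by move=> l; rewrite map_unitmx.
  - by move=> l; rewrite map_unitmx -(map_unitmx j) jb.
  - by move=> J; rewrite array_act_support_map; apply: sa.
  - move=> J; rewrite -cE array_act_support_map.
    rewrite -(array_act_support_map j) cj.
    have -> : (fun l => map_mx j (b l)) = a by apply: functional_extensionality_dep.
    exact: sa.
  - exact: optE.
pose b i := projT1 (cid2 (descent i)).
have ub i : b i \in unitmx by rewrite /b; case: cid2.
have pb i : parabolic (lam i) (invmx (a i) *m map_mx iM (b i)).
  by rewrite /b; case: cid2.
exists b, lam, m; split=> // J.
rewrite -(array_act_support_map iM).
have -> : (fun i => map_mx iM (b i)) = (fun i => a i *m (invmx (a i) *m map_mx iM (b i))).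
  by apply: functional_extensionality_dep => i; rewrite mulKVmx.
by rewrite -array_actM; apply: supported_parabolic.
Qed.

End Kempf.

(** * Integral weights *)

Section Integral.
Variables (R : realType) (d : nat) (alpha : 'I_d -> R).
Hypothesis alpha_gt0 : forall i, 0 < alpha i.

(** The statement that a one-parameter subgroup with weights lam, diagonal in
    some basis, witnesses that the stable rank is below r. *)
Definition destabilized (n : 'I_d -> nat) (F : fieldType) (c : array_index n -> F) (r : R) :=
  exists (a : forall i, 'M[F]_(n i)) (lam : forall i, 'I_(n i) -> nat) (M : nat),
    [/\ forall i, a i \in unitmx,
        forall J, array_act c a J != 0 -> (M <= \sum_i lam i (J i))%N &
        \sum_i alpha i * (\sum_j lam i j)%:R < r * M%:R].

(** Scaling the weights by 1/B multiplies the linear part h of the instability by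
    1/B and the quadratic part by 1/B^2, so B only has to be large. *)
Lemma destabilized_real (n : 'I_d -> nat) (F : fieldType) (c : array_index n -> F) r :
  destabilized c r -> real_destabilized alpha r c.
Proof.
move=> [a [lam [M [ua sa cost_lt]]]].
pose C := \sum_i alpha i * (\sum_j lam i j)%:R.
pose h := r * M%:R - C.
have h0 : 0 < h by rewrite subr_gt0.
pose Q : R := \sum_i \sum_j (lam i j)%:R ^+ 2.
have Q0 : 0 <= Q by apply: sumr_ge0 => i _; apply: sumr_ge0 => j _; exact: sqr_ge0.
(* B dominates M and all the weights, which puts the scaled weights into the
   unit cube, and Q / h, which keeps the quadratic term below the linear one. *)
pose B : R := 1 + M%:R + \sum_i \sum_j (lam i j)%:R + Q / h.
have Qh0 : 0 <= Q / h by rewrite divr_ge0// ltW.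
have S0 : 0 <= \sum_i \sum_j (lam i j)%:R :> R.
  by apply: sumr_ge0 => i _; apply: sumr_ge0.
have M0 : 0 <= M%:R :> R by [].
have B0 : 0 < B by rewrite /B; lra.
have lamB i j : (lam i j)%:R <= B.
  have : (lam i j)%:R <= \sum_i \sum_j (lam i j)%:R :> R.
    rewrite (bigD1 i)//= (bigD1 j)//= -addrA lerDl addr_ge0//.
      by apply: sumr_ge0.
    by apply: sumr_ge0 => k _; apply: sumr_ge0.
  by rewrite /B; lra.
exists a, (fun i j => (lam i j)%:R / B), (M%:R / B); split=> //.
- split=> [i j|]; rewrite divr_ge0 ?(ltW B0)//= ler_pdivrMr// mul1r //.
  by rewrite /B; lra.
- move=> J /sa leM; rewrite /weight_of -big_distrl ler_pM2r ?invr_gt0//=.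
  by rewrite -natr_sum ler_nat.
rewrite /instability /weight_cost /weight_norm.
have -> : \sum_i alpha i * (\sum_j (lam i j)%:R / B) = C / B.
  rewrite /C big_distrl; apply: eq_bigr => i _ /=.
  by rewrite -big_distrl -mulrA natr_sum.
have -> : \sum_i \sum_j ((lam i j)%:R / B) ^+ 2 = Q / B / B.
  rewrite -mulrA /Q big_distrl; apply: eq_bigr => i _ /=; rewrite big_distrl.
  by apply: eq_bigr => j _ /=; rewrite -invfM -expr2 exprMn exprVn.
have -> : r * (M%:R / B) - C / B - Q / B / B = (h - Q / B) / B.
  by rewrite /h; ring.
rewrite divr_gt0// subr_gt0 ltr_pdivrMr// mulrC -ltr_pdivrMr//.
by rewrite /B; lra.
Qed.

(** For a large multiple D, rounding the weights D lam up and the bound D m down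
    preserves the support condition and changes the two sides of the strict
    inequality by a bounded amount. *)
Lemma real_destabilized_integral (n : 'I_d -> nat) (F : fieldType) (c : array_index n -> F) r :
  real_destabilized alpha r c -> destabilized c r.
Proof.
move=> [a [lam [m [ua [bl /andP[m0 m1]] sa ins]]]].
have nrm0 : 0 <= weight_norm lam.
  by apply: sumr_ge0 => i _; apply: sumr_ge0 => j _; exact: sqr_ge0.
have cost0 : 0 <= weight_cost alpha lam.
  apply: sumr_ge0 => i _; apply: mulr_ge0; first exact: ltW.
  by apply: sumr_ge0 => j _; case/andP: (bl i j).
pose h := r * m - weight_cost alpha lam.
have h0 : 0 < h by move: ins; rewrite /instability /h; lra.
have r0 : 0 < r.
  rewrite ltNge; apply/negP => r0; have : r * m <= 0 by rewrite mulr_le0_ge0.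
  by move: h0; rewrite /h; lra.
pose A := \sum_i alpha i * (n i)%:R.
have A0 : 0 <= A by apply: sumr_ge0 => i _; rewrite mulr_ge0// ltW.
(* Rounding costs at most A on the left-hand side and r on the right-hand one. *)
pose D := Num.bound ((r + A) / h).
have DP : r + A < h * D%:R.
  rewrite mulrC -ltr_pdivrMr//; apply: archi_boundP.
  by apply: divr_ge0; [apply: addr_ge0 => //; apply: ltW|apply: ltW].
have up x : 0 <= x -> x < (Num.truncn x).+1%:R :> R.
  by move=> x0; have /andP[] := truncn_itv x0.
exists a, (fun i j => (Num.truncn (D%:R * lam i j)).+1), (Num.truncn (D%:R * m)).
have Dl0 i j : 0 <= D%:R * lam i j by rewrite mulr_ge0//; case/andP: (bl i j).
have Dm0 : 0 <= D%:R * m by rewrite mulr_ge0.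
split=> //.
- move=> J /sa leM; rewrite -(ler_nat R).
  have /andP[le1 _] := truncn_itv Dm0; apply: le_trans le1 _.
  apply: (@le_trans _ _ (D%:R * weight_of lam J)); first by rewrite ler_wpM2l.
  rewrite /weight_of big_distrr natr_sum; apply: ler_sum => i _.
  by apply: ltW; apply: up; apply: Dl0.
have lt2 := up _ Dm0.
apply: (@le_lt_trans _ _ (D%:R * weight_cost alpha lam + A)).
  rewrite /weight_cost /A big_distrr -big_split; apply: ler_sum => i _ /=.
  rewrite mulrCA -mulrDr ler_pM2l// big_distrr natr_sum.
  have -> : (n i)%:R = \sum_(j < n i) 1 :> R by rewrite sumr_const card_ord.
  rewrite -big_split /=.
  apply: ler_sum => j _; rewrite -[_.+1]addn1 natrD lerD2r.
  by have /andP[] := truncn_itv (Dl0 i j).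
have : r * (D%:R * m) < r * (Num.truncn (D%:R * m)).+1%:R by rewrite ltr_pM2l.
rewrite -[_.+1]addn1 natrD; move: DP; rewrite /h; nra.
Qed.

Lemma destabilized_descent (K L : fieldType) (iota : {rmorphism K -> L})
    (n : 'I_d -> nat) (c : array_index n -> K) r :
  perfect_field K -> destabilized (iota \o c) r -> destabilized c r.
Proof.
move=> perfK /destabilized_real dL; apply: real_destabilized_integral.
exact: real_destabilized_descent dL.
Qed.

Lemma destabilized_map (K L : fieldType) (iota : {rmorphism K -> L})
    (n : 'I_d -> nat) (c : array_index n -> K) r :
  destabilized c r -> destabilized (iota \o c) r.
Proof.
move=> [a [lam [M [ua sa cost_lt]]]].
exists (fun i => map_mx iota (a i)), lam, M; split=> // [i|J].
  by rewrite map_unitmx.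
by rewrite array_act_support_map; apply: sa.
Qed.

Lemma destabilized_basis_change (F : fieldType) (n p : 'I_d -> nat)
    (c : array_index n -> F) (h : forall i, 'M[F]_(n i, p i))
    (h' : forall i, 'M[F]_(p i, n i)) r :
  (forall i, h i *m h' i = 1%:M) -> (forall i, h' i *m h i = 1%:M) ->
  destabilized (array_act c h) r -> destabilized c r.
Proof.
move=> hh' h'h.
have np : n = p.
  by apply/funext => i; apply/eqP; rewrite eqn_leq (mulmx1_min (hh' i)) (mulmx1_min (h'h i)).
case: p / np h h' hh' h'h => h h' hh' h'h [a [lam [M [ua sa cost_lt]]]].
exists (fun i => h i *m a i), lam, M; split=> // [i|J].
  by rewrite unitmx_mul ua andbT; case/mulmx1_unit: (hh' i).
by rewrite -array_actM; apply: sa.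
Qed.

End Integral.

(** * Power series *)

Section Fps.
Variable F : fieldType.
Implicit Types f g h : fps F.
Local Notation X := (fps_X F).

Definition fps_eval0 f : F := fps_coef f 0.

Lemma fps_coefD f g k : fps_coef (f + g) k = fps_coef f k + fps_coef g k.
Proof. by []. Qed.

Lemma fps_coefN f k : fps_coef (- f) k = - fps_coef f k.
Proof. by []. Qed.

Lemma fps_coefM f g k :
  fps_coef (f * g) k = \sum_(i < k.+1) fps_coef f i * fps_coef g (k - i).
Proof. by []. Qed.

Lemma fps_eval0_zmod : zmod_morphism fps_eval0.
Proof. by []. Qed.

Lemma fps_eval0_monoid : monoid_morphism fps_eval0.
Proof. by split=> // f g; rewrite /fps_eval0 fps_coefM big_ord1. Qed.

HB.instance Definition _ :=
  GRing.isZmodMorphism.Build (fps F) F fps_eval0 fps_eval0_zmod.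
HB.instance Definition _ :=
  GRing.isMonoidMorphism.Build (fps F) F fps_eval0 fps_eval0_monoid.

Lemma fps_const_zmod : zmod_morphism (@fps_const F).
Proof. by move=> a b; apply: fpsP => k /=; case: eqP => // _; rewrite subr0. Qed.

Lemma fps_const_monoid : monoid_morphism (@fps_const F).
Proof.
split=> // a b; apply: fpsP => k; rewrite fps_coefM big_ord_recl /= subn0.
rewrite big1 ?addr0 => [|i _]; last by rewrite mul0r.
by case: eqP => // _; rewrite mulr0.
Qed.

HB.instance Definition _ :=
  GRing.isZmodMorphism.Build F (fps F) (@fps_const F) fps_const_zmod.
HB.instance Definition _ :=
  GRing.isMonoidMorphism.Build F (fps F) (@fps_const F) fps_const_monoid.

Lemma fps_coefXM f k : fps_coef (X * f) k = if k is k'.+1 then fps_coef f k' else 0.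
Proof.
rewrite fps_coefM; case: k => [|k]; first by rewrite big_ord1 /= mul0r.
rewrite big_ord_recl /= mul0r add0r big_ord_recl /= mul1r subSS subn0.
by rewrite big1 ?addr0// => i _; rewrite mul0r.
Qed.

Lemma fps_coefXnM n f k :
  fps_coef (X ^+ n * f) k = if (k < n)%N then 0 else fps_coef f (k - n).
Proof.
elim: n k => [|n IH] k; first by rewrite expr0 mul1r subn0.
by rewrite exprS -mulrA fps_coefXM; case: k => // k; rewrite IH ltnS subSS.
Qed.

Lemma fps_Xn_dvdP n f :
  (exists g, f = X ^+ n * g) <-> (forall k, (k < n)%N -> fps_coef f k = 0).
Proof.
split=> [[g ->] k kn|f0]; first by rewrite fps_coefXnM kn.
exists (Fps (fun k => fps_coef f (k + n))); apply: fpsP => k.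
by rewrite fps_coefXnM; case: ltnP => [/f0//|nk] /=; rewrite subnK.
Qed.

Lemma fps_X_neq0 : X != 0.
Proof.
by apply/eqP => /(congr1 (fun f => fps_coef f 1)) /eqP; rewrite /= oner_eq0.
Qed.

Lemma fps_Xn_factor f : f != 0 -> exists k u, f = X ^+ k * u /\ fps_eval0 u != 0.
Proof.
move=> /fps_neq0_order[k fk f0]; exists k.
have [_ /(_ f0)[u fu]] := fps_Xn_dvdP k f; exists u; split=> //.
by move: fk; rewrite fu fps_coefXnM ltnn subnn.
Qed.

(** The inverse of 1 - x, for x divisible by t, is the geometric series; its k-th
    coefficient is that of any partial sum with more than k terms. *)
Lemma fps_unitP f : (f \is a GRing.unit) = (fps_eval0 f != 0).
Proof.
apply/idP/idP => [|f0]; first by move=> /(rmorph_unit (@fps_eval0)); rewrite unitfE.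
pose x := 1 - fps_const (fps_eval0 f)^-1 * f.
have x0 : fps_eval0 x = 0.
  by rewrite rmorphB rmorph1 rmorphM /= /fps_eval0 /= mulVf// subrr.
have [_ /(_ _)[|y xy]] := fps_Xn_dvdP 1 x.
  by case.
pose g := Fps (fun k => fps_coef (\sum_(i < k.+1) x ^+ i) k).
(* Every partial sum that is long enough has the same k-th coefficient. *)
have gE N k : (k <= N)%N -> fps_coef g k = fps_coef (\sum_(i < N.+1) x ^+ i) k.
  elim: N => [|N IH]; first by rewrite leqn0 => /eqP->.
  rewrite leq_eqVlt => /orP[/eqP->//|]; rewrite ltnS => kN; rewrite (IH kN).
  rewrite [in RHS]big_ord_recr fps_coefD.
  have -> : fps_coef (x ^+ N.+1) k = 0 by rewrite xy expr1 exprMn fps_coefXnM ltnS kN.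
  by rewrite addr0.
have geo N : (1 - x) * (\sum_(i < N.+1) x ^+ i) = 1 - x ^+ N.+1.
  rewrite -[in RHS](expr1n _ N.+1) subrXX; congr (_ * _).
  by apply: eq_bigr => i _; rewrite expr1n mul1r.
have xg : (1 - x) * g = 1.
  apply: fpsP => k; rewrite fps_coefM.
  transitivity (fps_coef ((1 - x) * (\sum_(i < k.+1) x ^+ i)) k).
    by rewrite fps_coefM; apply: eq_bigr => i _; rewrite (gE k)// leq_subr.
  by rewrite geo fps_coefD fps_coefN xy expr1 exprMn fps_coefXnM ltnSn subr0.
apply/unitrP; exists (fps_const (fps_eval0 f)^-1 * g).
have fg : f * (fps_const (fps_eval0 f)^-1 * g) = 1.
  by rewrite -[RHS]xg /x opprB addrC subrK mulrA [f * _]mulrC.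
by rewrite fg mulrC.
Qed.

(** A nonzero entry of minimal order in the remaining rows divides all their
    entries, so it can serve as a pivot for both its row and its column. *)
Lemma smith n (g : 'M[fps F]_n) : \det g != 0 ->
  exists a w b, [/\ a \in unitmx, b \in unitmx, g = a *m w *m b &
    exists c, monomial_mx w c].
Proof.
pose A (a : 'M[fps F]_n) := (a \in unitmx) : Prop.
have A1 : A 1%:M by exact: unitmx1.
have AM a a' : A a -> A a' -> A (a *m a') by rewrite /A unitmx_mul => -> ->.
apply: (@monomial_factorization _ _ A A A1 AM A1 AM) => {}g I i1 i1I row_g done_g.
have ordP (x : 'I_n * 'I_n) : exists ku : nat * fps F,
    g x.1 x.2 != 0 -> g x.1 x.2 = X ^+ ku.1 * ku.2 /\ fps_eval0 ku.2 != 0.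
  have [->|/fps_Xn_factor[k [u H]]] := eqVneq (g x.1 x.2) 0.
    by exists (0%N, 0).
  by exists (k, u).
pose ord x := (projT1 (cid (ordP x))).1.
have [j1 gj1] := row_g i1.
pose P (x : 'I_n * 'I_n) := (x.1 \notin I) && (g x.1 x.2 != 0).
have P1 : P (i1, j1) by rewrite /P /= i1I.
have [[i0 j0] /andP[/= i0I gij] omin] :
    exists2 x, P x & forall y, P y -> (ord x <= ord y)%N.
  by case: (@arg_minnP _ (i1, j1) P ord P1) => x Px xmin; exists x.
have dvd i j : i \notin I -> exists q, g i j = q * g i0 j0.
  move=> iI; have [->|gij'] := eqVneq (g i j) 0; first by exists 0; rewrite mul0r.
  have := omin (i, j); rewrite /P /= iI gij' /ord => /(_ isT).
  case: (cid (ordP (i0, j0))) => [[k u] /= /(_ gij)[-> u0]].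
  case: (cid (ordP (i, j))) => [[k' u'] /= /(_ gij')[-> u'0]] kk'.
  exists (X ^+ (k' - k) * u' * u^-1); rewrite -(subnK kk') addnK exprD.
  by rewrite [_ * u']mulrAC [_ * u^-1 * _]mulrACA mulVr ?mulr1 ?fps_unitP//.
have dvd_r i : exists q, (i == i0 -> q = 0) /\ (i != i0 -> g i j0 = q * g i0 j0).
  have [->|ii0] := eqVneq i i0; first by exists 0.
  (* The entries of the finished rows lie in finished columns, and j0 is not one
     of those. *)
  have [iI|iI] := boolP (i \in I); last by have [q gq] := dvd i j0 iI; exists q.
  exists 0; split=> // _; rewrite mul0r; apply/eqP; apply: contraNT gij => gi0.
  by apply/eqP; apply: (done_g i).
have dvd_s j : exists q, (j == j0 -> q = 0) /\ (j != j0 -> g i0 j = g i0 j0 * q).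
  have [->|jj0] := eqVneq j j0; first by exists 0.
  by have [q ->] := dvd i0 j i0I; exists q; rewrite mulrC.
pose r i := projT1 (cid (dvd_r i)); pose s j := projT1 (cid (dvd_s j)).
have [r0 rP] : r i0 = 0 /\ forall i, i != i0 -> g i j0 = r i * g i0 j0.
  split=> [|i]; rewrite /r; case: cid => q [q0 qP] /=; [exact: q0|exact: qP].
have [s0 sP] : s j0 = 0 /\ forall j, j != j0 -> g i0 j = g i0 j0 * s j.
  split=> [|i]; rewrite /s; case: cid => q [q0 qP] /=; [exact: q0|exact: qP].
exists i0, j0, r, s; split; first by split.
split; [|  |exact: rP|exact: sP].
  exact: (proj1 (mulmx1_unit (col_shearN r0))).
exact: (proj2 (mulmx1_unit (row_shearN s0))).
Qed.

End Fps.

(** * Coordinates and valuations on the extended tensor product *)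

Section Coordinates.
Variables (F E : fieldType) (iota : {rmorphism F -> E}) (d : nat).
Variables (U : 'I_d -> vectType F).
Local Notation dims := (fun i => \dim {:U i}).
Local Notation W := (fun i => extension iota (U i)).

(** The coordinates of a tensor over the extended spaces refer to the chosen
    basis of 'rV, about which nothing is known; these matrices convert them to
    the coordinates with respect to the standard rows. *)
Definition vbasis_mx i : 'M[E]_(\dim {:W i}, \dim {:U i}) :=
  \matrix_(k, j) ((vbasis {:W i})`_k : 'rV[E]_(\dim {:U i})) 0 j.

Definition vbasis_inv i : 'M[E]_(\dim {:U i}, \dim {:W i}) :=
  \matrix_(j, k) coord (vbasis {:W i}) k (delta_mx 0 j : 'rV[E]_(\dim {:U i})).

Lemma vbasis_mxE i (w : W i) j :
  \sum_k coord (vbasis {:W i}) k w * vbasis_mx i k j = (w : 'rV[E]_(\dim {:U i})) 0 j.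
Proof.
have := coord_vbasis (memvf w) => wE; rewrite [in RHS]wE.
rewrite summxE; apply: eq_bigr => k _; by rewrite !mxE.
Qed.

Lemma vbasis_mxK i : vbasis_mx i *m vbasis_inv i = 1%:M.
Proof.
apply/matrixP => k l; rewrite !mxE.
under eq_bigr do rewrite !mxE.
transitivity (coord (vbasis {:W i}) l (vbasis {:W i})`_k).
  rewrite [in RHS](row_sum_delta ((vbasis {:W i})`_k : 'rV[E]_(\dim {:U i}))).
  by rewrite linear_sum; apply: eq_bigr => j _; rewrite linearZ.
by rewrite coord_free ?(basis_free (vbasisP _))// eq_sym.
Qed.

Lemma vbasis_invK i : vbasis_inv i *m vbasis_mx i = 1%:M.
Proof.
apply/matrixP => j l; rewrite mxE; under eq_bigr do rewrite [vbasis_inv _ _ _]mxE.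
by rewrite vbasis_mxE !mxE eqxx /= eq_sym.
Qed.

Definition standard_coords (x : tensor W) : array_index dims -> E :=
  array_act (x : array_index (fun i => \dim {:W i}) -> E) vbasis_mx.

Lemma standard_coords_inj : injective standard_coords.
Proof.
move=> x y /(congr1 (fun c => array_act c vbasis_inv)).
rewrite /standard_coords !array_actM.
have -> : (fun i => vbasis_mx i *m vbasis_inv i) = fun i => 1%:M.
  by apply: functional_extensionality_dep => i; apply: vbasis_mxK.
by rewrite !array_act1 => xy; apply/ffunP => f; rewrite xy.
Qed.

Lemma standard_coords_pure (w : forall i, W i) J :
  standard_coords (pure_tensor w) J =
  \prod_i (w i : 'rV[E]_(\dim {:U i})) 0 (J i).
Proof.
rewrite /standard_coords /array_act.
transitivity (\sum_(f : array_index (fun i => \dim {:W i})) \prod_i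
    (coord (vbasis {:W i}) (f i) (w i) * vbasis_mx i (f i) (J i))).
  by apply: eq_bigr => f _; rewrite ffunE -big_split.
rewrite -(bigA_distr_dffun (fun i k =>
  coord (vbasis {:W i}) k (w i) * vbasis_mx i k (J i))).
by apply: eq_bigr => i _; rewrite vbasis_mxE.
Qed.

Lemma standard_coords_sum (I : finType) (a : I -> E) (x : I -> tensor W) J :
  standard_coords (\sum_k a k *: x k) J = \sum_k a k * standard_coords (x k) J.
Proof.
rewrite /standard_coords /array_act.
under [RHS]eq_bigr do rewrite big_distrr /=.
rewrite exchange_big; apply: eq_bigr => f _ /=.
rewrite sum_ffunE big_distrl /=; apply: eq_bigr => k _.
by rewrite ffunE mulrA.
Qed.

Lemma standard_coords_extend (x : tensor U) :
  standard_coords (tensor_extend iota x) = iota \o x.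
Proof.
apply/funext => J; rewrite standard_coords_sum (bigD1 J)//= big1 ?addr0 => [|f fJ].
  rewrite standard_coords_pure big1 ?mulr1// => i _.
  by rewrite mxE coord_free ?(basis_free (vbasisP _))// eqxx rmorph1.
rewrite standard_coords_pure.
suff [i fi] : exists i, f i != J i.
  rewrite (bigD1 i)//= mxE coord_free ?(basis_free (vbasisP _))//.
  by rewrite (negPf fi) rmorph0 mul0r mulr0.
apply/existsP; rewrite -negb_forall; apply: contra fJ => /forallP fJ.
by apply/eqP; apply/ffunP => i; apply/eqP; apply: fJ.
Qed.

End Coordinates.

Section Valuation.
Variables (R : realType) (F : fieldType) (d : nat) (U : 'I_d -> vectType F).
Local Notation dims := (fun i => \dim {:U i}).
Local Notation X := (fps_X F).
Local Notation coords := (@standard_coords F _ laurent_const d U).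

(** In standard coordinates the lattice F[[t]] (x) U consists of the arrays of
    power series, which makes valuations computable coordinatewise. *)
Lemma integral_latticeP (y : tensor (fun i => extension laurent_const (U i))) :
  integral_lattice (@tensor_extend F _ laurent_const d U) y <->
  exists s : array_index dims -> fps F, coords y = laurent_of_fps \o s.
Proof.
split=> [[N [s [w ->]]]|[s ys]].
  exists (fun J => \sum_k s k * fps_const (w k J)); apply/funext => J.
  rewrite standard_coords_sum /= rmorph_sum; apply: eq_bigr => k _.
  by rewrite standard_coords_extend rmorphM.
exists #|{: tensor_index U}|, (fun k => s (enum_val k)).
exists (fun k => [ffun f : tensor_index U => (f == enum_val k)%:R : F^o]).
apply: standard_coords_inj; rewrite ys; apply/funext => J.
rewrite standard_coords_sum (bigD1 (enum_rank J))//= big1 ?addr0 => [|k kJ].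
  by rewrite standard_coords_extend /= ffunE enum_rankK eqxx rmorph1 mulr1.
rewrite standard_coords_extend /= ffunE; case: eqP => [Jk|_]; last by rewrite rmorph0 mulr0.
by rewrite Jk enum_valK eqxx in kJ.
Qed.

Lemma standard_coordsZ (a : laurent F) x J : coords (a *: x) J = a * coords x J.
Proof.
have := @standard_coords_sum _ _ laurent_const d U 'I_1 (fun=> a) (fun=> x) J.
by rewrite !big_ord1.
Qed.

Lemma laurent_of_fps_inj : injective (@laurent_of_fps F).
Proof. by move=> f g /eqP; rewrite /laurent_of_fps tofrac_eq => /eqP. Qed.

Local Open Scope ereal_scope.

Lemma val_tensor_ge x (f : array_index dims -> fps F) (M : nat) :
  coords x = laurent_of_fps \o f -> (forall J, exists g, f J = X ^+ M * g)%R ->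
  M%:R%:E <= val_tensor R x.
Proof.
move=> xf fM; apply: ereal_sup_ubound; exists M%:Z => //.
pose s J := projT1 (cid (fM J)).
have sP J : f J = (X ^+ M * s J)%R by rewrite /s; case: cid.
exists ((laurent_t ^ M%:Z)^-1 *: x)%R.
  apply/integral_latticeP; exists s; apply/funext => J.
  rewrite standard_coordsZ xf /= sP rmorphM rmorphXn /= mulKf//.
  by rewrite expf_neq0// -(rmorph0 laurent_of_fps) (inj_eq laurent_of_fps_inj) fps_X_neq0.
rewrite scalerA mulfV ?scale1r//.
by rewrite expf_neq0// -(rmorph0 laurent_of_fps) (inj_eq laurent_of_fps_inj) fps_X_neq0.
Qed.

(** The valuation is only approached from below here: a real lower bound is all
    that the comparison of a quotient with r provides, and for x = 0 the supremum
    is not attained. *)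
Lemma val_tensor_gt x (f : array_index dims -> fps F) (b : R) :
  coords x = laurent_of_fps \o f -> (0 <= b)%R -> b%:E < val_tensor R x ->
  exists2 M : nat, (b < M%:R)%R & forall J, exists g, (f J = X ^+ M * g)%R.
Proof.
move=> xf b0 /ereal_sup_gt[_ [m [y /integral_latticeP[s ys] xy] <-]].
rewrite lte_fin => bm; have m0 : (0 < m)%R by rewrite -(ltr0z R) (le_lt_trans b0).
case: m m0 bm xy => // M _ bM xy; exists M => // J.
exists (s J); apply: laurent_of_fps_inj.
by have := congr1 (coords ^~ J) xy; rewrite standard_coordsZ ys xf /= rmorphM rmorphXn.
Qed.

Lemma val_scalar_Xn (k : nat) (u : fps F) : fps_eval0 u != 0%R ->
  val_scalar R (laurent_of_fps (X ^+ k * u)%R) = k%:R%:E.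
Proof.
move=> u0; apply/eqP; rewrite eq_le; apply/andP; split.
  apply: ge_ereal_sup => _ [m [y [N [s [w ->]]] ku] <-].
  rewrite lee_fin; case: m ku => [m|m] ku; last first.
    by rewrite (le_trans _ (ler0n _ _))// NegzE mulrNz oppr_le0.
  rewrite ler_nat leqNgt; apply: contra u0 => km; apply/eqP.
  have : (X ^+ k * u = X ^+ m * \sum_(l < N) s l * fps_const (w l))%R.
    apply: laurent_of_fps_inj; rewrite ku.
    rewrite [in RHS]rmorphM rmorphXn rmorph_sum; congr (_ * _)%R.
    by apply: eq_bigr => l _; rewrite rmorphM.
  rewrite -(subnKC km) addSn -addnS exprD -mulrA => /mulfI ->.
    by rewrite /fps_eval0 fps_coefXnM.
  by rewrite expf_neq0// fps_X_neq0.
apply: ereal_sup_ubound; exists k%:Z => //.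
exists (laurent_of_fps u : (laurent F)^o); last by rewrite rmorphM rmorphXn.
exists 1%N, (fun=> u), (fun=> 1%R); rewrite big_ord1 rmorph1.
by rewrite [RHS]mulr1.
Qed.

End Valuation.

(** * The stable rank as an instability threshold *)

Lemma det_monomial (S : idomainType) n (w : 'M[S]_n) (s : 'I_n -> 'I_n) :
  monomial_mx w s -> exists b : bool, \det w = (-1) ^+ b * \prod_i w i (s i).
Proof.
move=> [inj_s ws]; exists (perm.odd_perm (perm.perm inj_s)).
have -> : w = diag_mx (\row_i w i (s i)) *m perm_mx (perm.perm inj_s).
  apply/matrixP => i j; rewrite mul_diag_mx !mxE perm.permE.
  have [->|ij] := eqVneq (s i) j; first by rewrite mulr1.
  by rewrite mulr0; apply/eqP; rewrite -[_ == _]negbK ws eq_sym.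
rewrite det_mulmx det_diag det_perm mulrC; congr (_ * _).
by apply: eq_bigr => i _; rewrite mxE mul_diag_mx !mxE perm.permE eqxx mulr1.
Qed.

Lemma array_act_dvd (S : comNzRingType) d (n p : 'I_d -> nat) (x : S)
    (c : array_index n -> S) (a : forall i, 'M[S]_(n i, p i)) :
  (forall J, exists q, c J = x * q) -> forall J, exists q, array_act c a J = x * q.
Proof.
move=> cx J; pose q f := projT1 (cid (cx f)).
have cE f : c f = x * q f by rewrite /q; case: cid.
exists (array_act q a J); rewrite big_distrr; apply: eq_bigr => f _ /=.
by rewrite cE mulrA.
Qed.

Lemma ereal_quotient_lt (R : realType) (C r : R) (V : \bar R) :
  0 <= C -> (0 < V)%E -> (C%:E / V < r%:E)%E <-> 0 < r /\ ((C / r)%:E < V)%E.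
Proof.
move=> C0; case: V => [x| |] //=; last first.
  by rewrite invey mule0 lte_fin => _; split=> [r0|[]//]; rewrite ltry.
rewrite lte_fin => x0; rewrite inver gt_eqF// -EFinM !lte_fin.
split=> [Cr|[r0 Cr]].
  have r0 : 0 < r by apply: le_lt_trans Cr; rewrite divr_ge0// ltW.
  by split=> //; rewrite ltr_pdivrMr// mulrC -ltr_pdivrMr.
by rewrite ltr_pdivrMr// mulrC -ltr_pdivrMr.
Qed.

Section Characterization.
Variables (R : realType) (F : fieldType) (d : nat) (U : 'I_d -> vectType F).
Variable (alpha : 'I_d -> R).
Hypothesis alpha_gt0 : forall i, 0 < alpha i.
Local Notation dims := (fun i => \dim {:U i}).
Local Notation X := (fps_X F).
Local Notation coords := (@standard_coords F _ laurent_const d U).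
Implicit Types (g : forall i, 'M[fps F]_(\dim {:U i})) (u : tensor U).

Lemma standard_coords_GL_act g u :
  coords (GL_act g u) = laurent_of_fps \o array_act (@fps_const F \o u) g.
Proof.
apply/funext => J.
transitivity (array_act (array_act (tensor_extend laurent_const u)
    (vbasis_mx laurent_const U)) (fun i => map_mx laurent_of_fps (g i)) J).
  rewrite standard_coords_sum array_actM /array_act; apply: eq_bigr => f _.
  rewrite standard_coords_pure; congr (_ * _); apply: eq_bigr => i _.
  by rewrite !mxE; apply: eq_bigr => k _; rewrite [in RHS]mxE.
rewrite -[array_act (tensor_extend _ _) _]/(coords _) standard_coords_extend.
by rewrite [RHS]array_act_map.
Qed.

Lemma stable_cost g (k : forall i, nat) (w : forall i, fps F) :
  (forall i, \det (g i) = X ^+ k i * w i /\ fps_eval0 (w i) != 0) ->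
  (\sum_(i < d) (alpha i)%:E * val_scalar R (laurent_of_fps (\det (g i))) =
   (\sum_i alpha i * (k i)%:R)%:E)%E.
Proof.
move=> gw; rewrite -sumEFin; apply: eq_bigr => i _.
by have [-> w0] := gw i; rewrite val_scalar_Xn// EFinM.
Qed.

Lemma GL_fpsE g : GL_fps g <-> forall i, \det (g i) != 0.
Proof.
have H i : (map_mx laurent_of_fps (g i) \in unitmx) = (\det (g i) != 0).
  rewrite unitmxE unitfE det_map_mx -(rmorph0 laurent_of_fps).
  by rewrite (inj_eq (@laurent_of_fps_inj F)).
by split=> H1 i; [rewrite -H|rewrite H]; apply: H1.
Qed.

(** From left to right, the Smith form g = a w b gives the basis a(0) and the
    orders of the entries of w as weights.  Conversely a weighted basis gives the
    one-parameter family a diag(t^lam). *)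
Lemma stable_rank_lt u (r : R) :
  (stable_rank alpha u < r%:E)%E <-> destabilized alpha (u : array_index dims -> F) r.
Proof.
have evK : @fps_eval0 F \o (@fps_const F \o u) = u by apply/funext.
split.
  move=> /ereal_inf_lt[_ [g [/GL_fpsE detg val_gt0] <-]].
  have smithP i : exists t : 'M[fps F]_(\dim {:U i}) * 'M[fps F]_(\dim {:U i}) *
      'M[fps F]_(\dim {:U i}) * ('I_(\dim {:U i}) -> 'I_(\dim {:U i})) *
      ('I_(\dim {:U i}) -> nat),
      [/\ t.1.1.1.1 \in unitmx, t.1.1.2 \in unitmx,
         g i = t.1.1.1.1 *m t.1.1.1.2 *m t.1.1.2, monomial_mx t.1.1.1.2 t.1.2 &
         forall j, exists v, t.1.1.1.2 j (t.1.2 j) = X ^+ t.2 j * v /\ fps_eval0 v != 0].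
    have [a [w [b [ua ub gE [s mw]]]]] := smith (detg i).
    have wX j : exists k, exists v, w j (s j) = X ^+ k * v /\ fps_eval0 v != 0.
      apply: fps_Xn_factor; by have [_ ->] := mw.
    exists (a, w, b, s, fun j => projT1 (cid (wX j))); split=> //= j.
    by case: cid.
  pose t i := projT1 (cid (smithP i)).
  pose a i := (t i).1.1.1.1; pose w i := (t i).1.1.1.2; pose b i := (t i).1.1.2.
  pose s i := (t i).1.2; pose lam i := (t i).2.
  have ua i : a i \in unitmx by rewrite /a /t; case: cid => ? [].
  have ub i : b i \in unitmx by rewrite /b /t; case: cid => ? [].
  have gE i : g i = a i *m w i *m b i by rewrite /a /w /b /t; case: cid => ? [].
  have mw i : monomial_mx (w i) (s i) by rewrite /w /s /t; case: cid => ? [].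
  have wX i j : exists v, w i j (s i j) = X ^+ lam i j * v /\ fps_eval0 v != 0.
    by rewrite /w /s /lam /t; case: cid => ? [].
  pose v i j := projT1 (cid (wX i j)).
  have vP i j : w i j (s i j) = X ^+ lam i j * v i j /\ fps_eval0 (v i j) != 0.
    by rewrite /v; case: cid.
  have prodw i : \prod_j w i j (s i j) = X ^+ (\sum_j lam i j) * \prod_j v i j.
    by rewrite expr_sum -big_split; apply: eq_bigr => j _; case: (vP i j).
  have detE i : exists v, \det (g i) = X ^+ (\sum_j lam i j) * v /\ fps_eval0 v != 0.
    have [e we] := det_monomial (mw i).
    exists (\det (a i) * (-1) ^+ e * (\prod_j v i j) * \det (b i)).
    split.
      rewrite gE !det_mulmx we prodw !mulrA; congr (_ * _ * _).
      by rewrite mulrC mulrA.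
    rewrite !rmorphM rmorph_prod !mulf_neq0//.
    - by rewrite -fps_unitP -unitmxE.
    - by rewrite rmorphXn rmorphN1 expf_neq0// oppr_eq0 oner_eq0.
    - by apply/prodf_neq0 => j _; case: (vP i j).
    - by rewrite -fps_unitP -unitmxE.
  pose v' i := projT1 (cid (detE i)).
  have costE := @stable_cost g (fun i => \sum_j lam i j)%N v' _.
  rewrite /stable_mu {}costE; last by move=> i; rewrite /v'; case: cid.
  set C := \sum_i _; move=> mu_lt.
  have C0 : 0 <= C by apply: sumr_ge0 => i _; rewrite mulr_ge0// ltW.
  have [r0 Cr] : 0 < r /\ ((C / r)%:E < val_tensor R (GL_act g u))%E.
    by apply/ereal_quotient_lt.
  have [|M CM uM] := val_tensor_gt (standard_coords_GL_act g u) _ Cr.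
    by rewrite divr_ge0// ltW.
  exists (fun i => map_mx (@fps_eval0 F) (a i)), lam, M; split.
  - move=> i; rewrite unitmxE det_map_mx; apply: rmorph_unit.
    by rewrite -unitmxE.
  - move=> J; rewrite -{1}evK -array_act_map; apply: contra_neqT.
    rewrite -ltnNge => ltM.
    have agE : array_act (array_act (@fps_const F \o u) a) w =
        array_act (array_act (@fps_const F \o u) g) (fun i => invmx (b i)).
      rewrite !array_actM; congr array_act.
      by apply: functional_extensionality_dep => i; rewrite gE mulmxK.
    have [q agq] : exists q,
        array_act (array_act (@fps_const F \o u) a) w (array_index_map s J) =
        X ^+ M * q.
      by rewrite agE; apply: array_act_dvd.
    move: agq; rewrite (array_act_monomial _ _ mw).
    have -> : \prod_i w i (J i) (s i (J i)) = X ^+ (\sum_i lam i (J i)) * \prod_i v i (J i).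
      by rewrite expr_sum -big_split; apply: eq_bigr => i _; case: (vP i (J i)).
    (* Both sides are divisible by the power of t of the weight of J; since M is
       larger, one power of t remains on the right. *)
    rewrite mulrCA -(subnKC ltM) addSn -addnS exprD -mulrA => /mulfI H.
    have {H}/(congr1 (@fps_eval0 F)) := H (expf_neq0 _ (fps_X_neq0 F)).
    rewrite rmorphM rmorph_prod [RHS]/fps_eval0 fps_coefXnM /= => /eqP.
    rewrite mulf_eq0 => /orP[/eqP//|/prodf_eq0[i _ /eqP vi0]].
    by have [_] := vP i (J i); rewrite vi0 eqxx.
  by rewrite mulrC -ltr_pdivrMr.
move=> [a [lam [M [ua sa cost_lt]]]].
pose D i := diag_mx (\row_j X ^+ lam i j).
pose g i := map_mx (@fps_const F) (a i) *m D i.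
have detE i : \det (g i) = X ^+ (\sum_j lam i j) * fps_const (\det (a i)) /\
    fps_eval0 (fps_const (\det (a i))) != 0.
  split; last by have := ua i; rewrite unitmxE unitfE.
  rewrite det_mulmx det_map_mx det_diag mulrC expr_sum; congr (_ * _).
  by apply: eq_bigr => j _; rewrite mxE.
have detg i : \det (g i) != 0.
  have [-> d0] := detE i; rewrite mulf_neq0 ?expf_neq0 ?fps_X_neq0//.
  by apply: contraNneq d0 => ->; rewrite rmorph0.
have mD i : monomial_mx (D i) id.
  split=> // j k; rewrite !mxE; have [->|] := eqVneq j k.
    by rewrite mulr1n expf_neq0// fps_X_neq0.
  by rewrite mulr0n eqxx.
have actE J : exists q, array_act (@fps_const F \o u) g J = X ^+ M * q.
  have -> : array_act (@fps_const F \o u) g J =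
      fps_const (array_act u a J) * X ^+ (\sum_i lam i (J i)).
    have JE : array_index_map (fun i => id) J = J by apply/ffunP => i; rewrite ffunE.
    rewrite array_act_map -array_actM -{1}JE (array_act_monomial _ _ mD).
    congr (_ * _); rewrite expr_sum; apply: eq_bigr => i _.
    by rewrite !mxE eqxx mulr1n.
  have [->|/sa leM] := eqVneq (array_act u a J) 0.
    by exists 0; rewrite rmorph0 mul0r mulr0.
  exists (X ^+ (\sum_i lam i (J i) - M) * fps_const (array_act u a J)).
  by rewrite mulrA -exprD subnKC// mulrC.
have val_ge := val_tensor_ge R (standard_coords_GL_act g u) actE.
set C := \sum_i _ in cost_lt.
have C0 : 0 <= C by apply: sumr_ge0 => i _; rewrite mulr_ge0// ltW.
have rM0 : 0 < r * M%:R by exact: le_lt_trans cost_lt.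
have M0 : 0 < M%:R :> R.
  by rewrite lt0r ler0n andbT; apply: contraTneq rM0 => ->; rewrite mulr0 ltxx.
have r0 : 0 < r by rewrite -(pmulr_lgt0 _ M0).
have val_gt0 : (0 < val_tensor R (GL_act g u))%E by apply: lt_le_trans val_ge.
have mu_lt : (stable_mu alpha g u < r%:E)%E.
  rewrite /stable_mu (@stable_cost g (fun i => \sum_j lam i j)%N _ detE).
  apply/ereal_quotient_lt => //; split=> //; apply: lt_le_trans val_ge.
  by rewrite lte_fin ltr_pdivrMr// mulrC.
apply: le_lt_trans mu_lt; apply: ereal_inf_lbound; exists g => //.
by split=> //; apply/GL_fpsE.
Qed.
End Characterization.

Lemma ereal_eq_lt (R : realType) (x y : \bar R) :
  (forall r : R, (x < r%:E)%E <-> (y < r%:E)%E) -> x = y.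
Proof.
move=> xy; apply/eqP; rewrite eq_le.
suff H (a b : \bar R) : (forall r : R, (a < r%:E)%E -> (b < r%:E)%E) -> (b <= a)%E.
  by apply/andP; split; apply: H => r /xy.
move=> ab; rewrite leNgt; apply/negP => lt_ab.
have [r /andP[ar rb]] : exists r : R, (a < r%:E <= b)%E.
  case: a b lt_ab {ab} => [a| |] [b| |]//= ab.
  - by exists b; rewrite lexx andbT.
  - by exists (a + 1); rewrite lte_fin ltrDl ltr01 leey.
  - by exists b; rewrite ltNyr lexx.
  - by exists 0; rewrite ltNyr leey.
by have := ab r ar; rewrite ltNge rb.
Qed.

Theorem theorem2p5 (R : realType) (K L : fieldType) (iota : {rmorphism K -> L})
    (perfK : perfect_field K) (d : nat) (V : 'I_d -> vectType K) (v : tensor V)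
    (alpha : 'I_d -> R) (alpha_gt0 : forall i, 0 < alpha i) :
  stable_rank alpha v = stable_rank alpha (tensor_extend iota v).
Proof.
apply: ereal_eq_lt => r.
apply: iff_trans (stable_rank_lt alpha_gt0 _ _) _.
apply: iff_sym; apply: iff_trans (stable_rank_lt alpha_gt0 _ _) _.
have coordsE := standard_coords_extend iota v.
split=> [dL|/(destabilized_map iota)].
  apply: (destabilized_descent alpha_gt0 (iota := iota) perfK).
  rewrite -coordsE.
  apply: (@destabilized_basis_change _ _ alpha _ _ _ _
    (vbasis_inv iota V) (vbasis_mx iota V)) => [i|i|].
  - exact: vbasis_invK.
  - exact: vbasis_mxK.
  rewrite array_actM.
  have -> : (fun i => vbasis_mx iota V i *m vbasis_inv iota V i) = fun i => 1%:M.
    by apply: functional_extensionality_dep => i; apply: vbasis_mxK.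
  by rewrite array_act1.
rewrite -coordsE; apply: destabilized_basis_change => i.
- exact: vbasis_mxK.
- exact: vbasis_invK.
Qed.
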